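(* Suppose that the regularity conditions listed in the context are satisfied. Let $W^\dagger$ be the Moore–Penrose inverse of $W=[\partial^2\ell(\phi,F_0)/\partial\phi\,\partial\phi^T]_{\phi=\phi_0}$, let $P_W$ be the orthogonal projection onto the column space of $W$, and let $g^*(X,Y,\phi_0,F_0)$ be the influence function at $F_0$ of the mapping $F\mapsto g(\phi_0,F)$, where $g(\phi_0,F)=[\partial\ell(\phi,F)/\partial\phi]_{\phi=\phi_0}$. Then $$P_W(\hat\phi-\phi_0)=-W^\dagger E_n g^*(X,Y,\phi_0,F_0)+o_p(n^{-1/2}).$$ The explicit expressions for $W$ and $g^*$ are as follows, where $R_1,\dots,R_5$, $R$ and their derivatives are evaluated at $(\phi_0,F_0)$, $E=E_{F_0}$, $\eta=\eta(\phi_0)$, $G=G(\eta^TX)$, $\dot G$ is the $k\times d$ Jacobian matrix of $G$ evaluated at $\eta^TX$, $H=H(Y)$, and $\dot\eta_{\phi_t}=[\partial\eta(\phi)/\partial\phi_t]_{\phi=\phi_0}$. For $t,u=1,\dots,m$, the $(t,u)$ entry of $W$ is $$W_{tu}=2\,\mathrm{tr}[(\partial_{\phi_t}R)R_5^{-1}(\partial_{\phi_u}R)^T],$$ $$\partial_{\phi_t}R=-(\partial_{\phi_t}R_2)R_3^{-1}R_4+R_2R_3^{-1}(\partial_{\phi_t}R_3)R_3^{-1}R_4-R_2R_3^{-1}(\partial_{\phi_t}R_4),$$ $$\partial_{\phi_t}R_2=E[XX^T\dot\eta_{\phi_t}\dot G^T],\quad \partial_{\phi_t}R_3=E(\dot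 G\dot\eta_{\phi_t}^TXG^T)+E(GX^T\dot\eta_{\phi_t}\dot G^T),\quad \partial_{\phi_t}R_4=E(\dot G\dot\eta_{\phi_t}^TXH^T),$$ where $\dot\eta_{\phi_t}$ consists of the first $d$ columns of $D_1(\phi_1)\cdots D_{t-1}(\phi_{t-1})[\partial_{\phi_t}D_t(\phi_t)]D_{t+1}(\phi_{t+1})\cdots D_m(\phi_m)$ at $\phi=\phi_0$, and $\partial_{\phi_t}D_t(\phi_t)$ is the $p\times p$ matrix whose $(i(t),j(t))\times(i(t),j(t))$ submatrix is $\begin{pmatrix}-\sin\phi_t&-\cos\phi_t\\ \cos\phi_t&-\sin\phi_t\end{pmatrix}$ and whose other elements are all $0$. The $t$th component of $g^*(X,Y,\phi_0,F_0)$ is $$g_t^*=2\,\mathrm{tr}[(\partial_{\phi_t}R)R_5^{-1}(R^* )^T],\qquad R^*=R_1^*-R_2^*R_3^{-1}R_4+R_2R_3^{-1}R_3^*R_3^{-1}R_4-R_2R_3^{-1}R_4^*,$$ $$R_1^*=XH^T-E[XH^T],\quad R_2^*=XG^T-E[XG^T],\quad R_3^*=GG^T-E[GG^T],\quad R_4^*=GH^T-E[GH^T].$$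
   Context: Data and notation. $(X_1,Y_1),\dots,(X_n,Y_n)$ are i.i.d. copies of $(X,Y)\sim F_0$, with $X$ a $p$-dimensional random vector and $Y$ a real random variable with sample space $\Omega_Y\subseteq\mathbb{R}$; $F_n$ is the empirical distribution; $E_nr(X,Y)=n^{-1}\sum_{i=1}^nr(X_i,Y_i)$; $E_F$ is expectation under $F$ and $E=E_{F_0}$. $\mathcal{F}$ is a convex class of distributions of $(X,Y)$ containing $F_0$ and the empirical distributions; moments and matrix inverses below are assumed to exist wherever used (for $F_n$, with probability tending to one). Basis functions. $H(y)=(h_1(y),\dots,h_s(y))^T$, where $h_1,\dots,h_s$ are monomials of $y$, one of them the constant $1$. $G(u)=(f_1(u),\dots,f_k(u))^T$, $u\in\mathbb{R}^d$, where $f_1,\dots,f_k$ are monomials in the components of $u$, one of them the constant $1$. Parameterization. Let $m=pd-d(d+1)/2$ and $\Omega_\phi=[0,\pi]^m$. Order the pairs $(i,j)$, $1\le i\le d$, $i<j\le p$, lexicographically ($j$ changing first), $t(i,j)=p(i-1)-(i-1)i/2+(j-i)$, and let $(i(t),j(t))$ be the $t$th pair. $D_t(\phi_t)$ is the $p\times p$ identity matrix with its $(i(t),j(t))\times(i(t),j(t))$ submatrix replaced by $\begin{pmatrix}\cos\phi_t&-\sin\phi_t\\ \sin\phi_t&\cos\phi_t\end{pmatrix}$. For $\phi=(\phi_1,\dots,\phi_m)^T$, $\eta(\phi)$ is the $p\times d$ matrix of the first $d$ columns of $D_1(\phi_1)D_2(\phi_2)\cdots D_m(\phi_m)$. Objective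 function. Let $R_1(F)=E_F[XH^T(Y)]$, $R_2(\phi,F)=E_F[XG^T(\eta^T(\phi)X)]$, $R_3(\phi,F)=E_F[G(\eta^T(\phi)X)G^T(\eta^T(\phi)X)]$, $R_4(\phi,F)=E_F[G(\eta^T(\phi)X)H^T(Y)]$, $R_5(F)=E_F[H(Y)H^T(Y)]$, $R(\phi,F)=R_1(F)-R_2(\phi,F)R_3^{-1}(\phi,F)R_4(\phi,F)$, and $$\ell(\phi,F)=\mathrm{tr}[R(\phi,F)R_5^{-1}(F)R^T(\phi,F)].$$ Equivalently, with $f(\eta^TX)=E_F[XG^T(\eta^TX)]\{E_F[G(\eta^TX)G^T(\eta^TX)]\}^{-1}G(\eta^TX)$, $\ell(\phi,F)=\mathrm{tr}\{E_F[(X-f)H^T](E_F[HH^T])^{-1}E_F[H(X-f)^T]\}$ with $\eta=\eta(\phi)$. For $F\in\mathcal{F}$, $\phi(F)\in\Omega_\phi$ denotes the minimizer of $\ell(\cdot,F)$ over $\Omega_\phi$, satisfying the first-order condition $[\partial\ell(\phi,F)/\partial\phi]_{\phi=\phi(F)}=0$; $\phi_0=\phi(F_0)$, $\hat\phi=\phi(F_n)$. Model assumption. Let $\rho(y,\tilde y)=H^T(y)\{E[H(Y)H^T(Y)]\}^{-1}H(\tilde y)$ and let $\tilde Y$ have the distribution of $Y$ and be independent of $(X,Y)$. A solution space is $\mathrm{span}(\beta)$ for a $p$-row matrix $\beta$ satisfying $E[X\rho(Y,\tilde Y)|\tilde Y]=E[E(X|\beta^TX)\rho(Y,\tilde Y)|\tilde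 Y]$ a.s.; the central solution space is the intersection of all solution spaces, assumed to be itself a solution space. It has dimension $d$, the columns of $\beta=\eta(\phi_0)$ form a basis of it, and each component of $E(X|\beta^TX)$ is a linear combination of $f_1(\beta^TX),\dots,f_k(\beta^TX)$. Influence functions. For a functional $A$ on $\mathcal{F}$ that is Fréchet differentiable at $F_0$ with respect to the sup norm $\|\cdot\|_\infty$, its derivative is represented by a random element $A^*(X,Y,F_0)$ (the influence function) with entries in $L_2(F_0)$, $E\,A^*(X,Y,F_0)=0$ and $[\frac{d}{d\alpha}A((1-\alpha)F_0+\alpha F)]_{\alpha=0}=E_FA^*(X,Y,F_0)$ for $F\in\mathcal{F}$. Regularity conditions. The functionals $F\mapsto\phi(F)$, $F\mapsto g(\phi_0,F)$ and $F\mapsto g(\phi(F),F)$, where $g(\phi,F)=\partial\ell(\phi,F)/\partial\phi$, are Fréchet differentiable at $F_0$ with respect to the sup norm $\|\cdot\|_\infty$, each with derivative represented by an influence function that has entries in $L_2(F_0)$, has mean zero under $F_0$, and whose expectation under any $F\in\mathcal{F}$ equals the derivative at $\alpha=0$ of the functional along $(1-\alpha)F_0+\alpha F$, and $\phi(\cdot)$ is asymptotically linear: $\phi(F_n)=\phi(F_0)+E_n\phi^*(X,Y,F_0)+o_p(n^{-1/2})$. *)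

(* Defs.v *)
From HB Require Import structures.
From mathcomp Require Import all_boot all_order all_algebra.
From mathcomp Require Import all_classical all_reals all_analysis.

Set Implicit Arguments.
Unset Strict Implicit.
Unset Printing Implicit Defensive.

Import Order.TTheory GRing.Theory Num.Theory.
Import numFieldNormedType.Exports.

Local Open Scope classical_set_scope.
Local Open Scope ring_scope.

(* An observation z = (x, y); x is a tuple because p.-tuple R carries the
   product sigma-algebra, whereas 'cV[R]_p has no measurable structure. *)
Notation obs R p := (p.-tuple R * R)%type.

Section Derivatives.
Context {R : realType}.

Definition pderive n (f : 'cV[R]_n -> R) (x : 'cV[R]_n) (t : 'I_n) : R :=
  derive1 (fun h : R => f (x + h *: delta_mx t 0)) 0.

Definition pderive_mx n k l (M : 'cV[R]_n -> 'M[R]_(k, l)) (x : 'cV[R]_n)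
    (t : 'I_n) : 'M[R]_(k, l) :=
  \matrix_(i, j) pderive (fun v => M v i j) x t.

Definition moore_penrose n (A B : 'M[R]_n) : Prop :=
  [/\ A *m B *m A = A, B *m A *m B = B,
      (A *m B)^T = A *m B & (B *m A)^T = B *m A].

Definition orth_proj_on_col n (A Q : 'M[R]_n) : Prop :=
  [/\ Q *m Q = Q, Q^T = Q & (Q^T == A^T)%MS].

Definition col_span p q (beta : 'M[R]_(p, q)) : set 'cV[R]_p :=
  [set v | (v^T <= beta^T)%MS].

End Derivatives.

Section Measures.
Context {R : realType}.

(* (1 - alpha) F + alpha G, with the junk value F when alpha is not in [0, 1] *)
Definition mixture d (T : measurableType d) (alpha : R)
    (F G : probability T R) : set T -> \bar R :=
  fun A => if 0 <= alpha <= 1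
           then ((1 - alpha)%:E * F A + alpha%:E * G A)%E else F A.

Section mixture_probability.
Context d (T : measurableType d) (alpha : R) (F G : probability T R).

Let mixtureE : 0 <= alpha <= 1 ->
  {m : {measure set T -> \bar R} | mixture alpha F G = m}.
Proof.
move=> a01; have /andP[a0 a1] := a01.
have b0 : 0 <= 1 - alpha by rewrite subr_ge0.
exists (measure_add (mscale (NngNum b0) F) (mscale (NngNum a0) G)).
by apply/funext => A; rewrite /mixture a01 [RHS]measure_addE.
Qed.

Let mixture0 : mixture alpha F G set0 = 0%E.
Proof.
have [/mixtureE[m ->]|/negbTE a01] := boolP (0 <= alpha <= 1).
  exact: measure0.
by rewrite /mixture a01 measure0.
Qed.

Let mixture_ge0 A : (0 <= mixture alpha F G A)%E.
Proof.
have [/mixtureE[m ->]|/negbTE a01] := boolP (0 <= alpha <= 1).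
  exact: measure_ge0.
by rewrite /mixture a01 measure_ge0.
Qed.

Let mixture_sigma_additive : semi_sigma_additive (mixture alpha F G).
Proof.
have [/mixtureE[m ->]|/negbTE a01] := boolP (0 <= alpha <= 1).
  exact: measure_semi_sigma_additive.
by rewrite /mixture a01; exact: measure_semi_sigma_additive.
Qed.

HB.instance Definition _ := isMeasure.Build _ _ _ (mixture alpha F G)
  mixture0 mixture_ge0 mixture_sigma_additive.

Let mixtureT : mixture alpha F G setT = 1%E.
Proof.
rewrite /mixture; case: ifPn => _; last exact: probability_setT.
by rewrite !probability_setT !mule1 -EFinD subrK.
Qed.

HB.instance Definition _ :=
  Measure_isProbability.Build _ _ _ (mixture alpha F G) mixtureT.

End mixture_probability.

Definition convex_class d (T : measurableType d) (calF : set (probability T R))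
    : Prop :=
  forall F G (alpha : R), calF F -> calF G -> 0 <= alpha <= 1 ->
    calF (mixture alpha F G).

(* the empirical distribution of the n.+1 points z 0, ..., z n *)
Definition empirical d (T : measurableType d) (z : nat -> T) (n : nat)
    : set T -> \bar R :=
  mscale (n.+1%:R^-1)%:nng (msum (fun i => \d_(z i)) n.+1).

Section empirical_probability.
Context d (T : measurableType d) (z : nat -> T) (n : nat).

HB.instance Definition _ := Measure.on (empirical z n).

Let empiricalT : empirical z n setT = 1%E.
Proof.
rewrite /empirical /mscale/= /msum (eq_bigr (fun=> 1%E)); last first.
  by move=> i _; exact: diracT.
by rewrite sumEFin sumr_const card_ord -EFinM mulVf.
Qed.

HB.instance Definition _ :=
  Measure_isProbability.Build _ _ _ (empirical z n) empiricalT.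

End empirical_probability.

Definition sample_mean (T : Type) k l (z : nat -> T) (n : nat)
    (M : T -> 'M[R]_(k, l)) : 'M[R]_(k, l) :=
  n.+1%:R^-1 *: \sum_(i < n.+1) M (z i).

Definition mx_integrable d (T : measurableType d) k l (F : probability T R)
    (M : T -> 'M[R]_(k, l)) : Prop :=
  forall i j, F.-integrable setT (EFin \o (fun z => M z i j)).

Definition mean d (T : measurableType d) k l (F : probability T R)
    (M : T -> 'M[R]_(k, l)) : 'M[R]_(k, l) :=
  \matrix_(i, j) \int[F]_z (M z i j).

(* h \o S is a version of the conditional expectation of f given S *)
Definition cond_exp d (T : measurableType d) d' (T' : measurableType d')
    (mu : {measure set T -> \bar R}) (f : T -> R) (S : T -> T') (h : T' -> R)
    : Prop :=
  [/\ mu.-integrable setT (EFin \o f), measurable_fun setT h,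
      mu.-integrable setT (EFin \o (h \o S)) &
      forall B, measurable B ->
        \int[mu]_(w in S @^-1` B) f w = \int[mu]_(w in S @^-1` B) h (S w)].

Definition iid dO (O : measurableType dO) d (T : measurableType d)
    (P : probability O R) (Z : nat -> {RV P >-> T}) (F : probability T R)
    : Prop :=
  (forall n A, measurable A -> distribution P (Z n) A = F A) /\
  (forall n (A : nat -> set T), (forall i, measurable (A i)) ->
    P (\bigcap_(i in `I_n) (Z i @^-1` A i)) =
    (\prod_(i < n) P (Z i @^-1` A i))%E).

(* V n = o_p(N^{-1/2}) for the sample size N = n.+1.  The outer measure of P,
   which coincides with P on events, spares measurability requirements on
   statistics such as phi(F_n). *)
Definition op_inv_sqrt dO (O : measurableType dO) (P : probability O R) m
    (V : nat -> O -> 'cV[R]_m) : Prop :=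
  forall i (eps : R), 0 < eps ->
    mu_ext P [set w | eps < Num.sqrt n.+1%:R * `|V n w i 0|] @[n --> \oo]
      --> 0%E.

Definition with_prob_to_one dO (O : measurableType dO) (P : probability O R)
    (E : nat -> set O) : Prop :=
  mu_ext P (~` E n) @[n --> \oo] --> 0%E.

End Measures.

Section Functionals.
Context {R : realType} {p : nat}.
Implicit Types F G : probability (obs R p) R.

Definition joint_cdf F (c : obs R p) : R :=
  fine (F [set z | (forall i, tnth z.1 i <= tnth c.1 i) /\ z.2 <= c.2]).

Definition sup_dist F G : R :=
  sup (range (fun c => `|joint_cdf F c - joint_cdf G c|)).

(* [calF] is the class of distributions, [D] the subset of it on which the
   functional [A] is meaningful.  The derivative at F0 is
   F - F0 |-> E_F A^* (Astar has mean zero under F0); mixtures are only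
   distributions for alpha in [0, 1], hence the right limit. *)
Definition frechet_with_influence m (calF D : set (probability (obs R p) R))
    F0 (A : probability (obs R p) R -> 'cV[R]_m) (Astar : obs R p -> 'cV[R]_m)
    : Prop :=
  [/\ forall i, (fun z => Astar z i 0) \in Lfun F0 2%:E,
      forall F, calF F -> mx_integrable F Astar,
      mean F0 Astar = 0,
      forall F, calF F -> forall i,
        alpha^-1 * (A (mixture alpha F0 F) i 0 - A F0 i 0) @[alpha --> 0^'+]
          --> mean F Astar i 0 &
      forall i (eps : R), 0 < eps -> exists2 delta : R, 0 < delta &
        forall F, D F -> sup_dist F F0 < delta ->
          `|A F i 0 - A F0 i 0 - mean F Astar i 0| <= eps * sup_dist F F0].

End Functionals.

Section Parameterization.
Context {R : realType} {p d : nat} (hdp : (d <= p)%N).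

Definition nang (p d : nat) : nat := (p * d - (d * d.+1)./2)%N.

(* 0-based pairs (i, j), i < d, i < j < p, in lexicographic order; there are
   nang p d of them when d <= p *)
Definition rot_pairs (p d : nat) : seq (nat * nat) :=
  [seq (i, j) | i <- iota 0 d, j <- iota i.+1 (p - i.+1)].

Definition rot_i (t : nat) : nat := (nth (0, 0) (rot_pairs p d) t).1%N.
Definition rot_j (t : nat) : nat := (nth (0, 0) (rot_pairs p d) t).2%N.

Definition rot_mx (t : nat) (theta : R) : 'M[R]_p :=
  \matrix_(r < p, c < p)
    if (r == rot_i t :> nat) && (c == rot_i t :> nat) then cos theta
    else if (r == rot_i t :> nat) && (c == rot_j t :> nat) then - sin theta
    else if (r == rot_j t :> nat) && (c == rot_i t :> nat) then sin theta
    else if (r == rot_j t :> nat) && (c == rot_j t :> nat) then cos theta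
    else (r == c)%:R.

Definition drot_mx (t : nat) (theta : R) : 'M[R]_p :=
  \matrix_(r < p, c < p)
    if (r == rot_i t :> nat) && (c == rot_i t :> nat) then - sin theta
    else if (r == rot_i t :> nat) && (c == rot_j t :> nat) then - cos theta
    else if (r == rot_j t :> nat) && (c == rot_i t :> nat) then cos theta
    else if (r == rot_j t :> nat) && (c == rot_j t :> nat) then - sin theta
    else 0.

Definition first_cols (M : 'M[R]_p) : 'M[R]_(p, d) := colsub (widen_ord hdp) M.

Definition eta_mx (phi : 'cV[R]_(nang p d)) : 'M[R]_(p, d) :=
  first_cols (\big[mulmx/1%:M]_(t < nang p d) rot_mx t (phi t 0)).

Definition deta_mx (phi : 'cV[R]_(nang p d)) (t : 'I_(nang p d)) : 'M[R]_(p, d) :=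
  first_cols (\big[mulmx/1%:M]_(u < nang p d)
    if u == t then drot_mx u (phi u 0) else rot_mx u (phi u 0)).

Definition Omega_phi : set 'cV[R]_(nang p d) :=
  [set phi | forall t, 0 <= phi t 0 <= pi].

End Parameterization.

Section Objective.
Context {R : realType} {p d s k : nat} (hdp : (d <= p)%N).
(* h_j(y) = y ^ hexp j and f_j(u) = \prod_l u_l ^ fexp j l *)
Context (hexp : 'I_s -> nat) (fexp : 'I_k -> 'I_d -> nat).
Implicit Types (F : probability (obs R p) R) (phi : 'cV[R]_(nang p d)).
Implicit Types (z : obs R p).

Definition xvec z : 'cV[R]_p := \col_i tnth z.1 i.

Definition hvec (y : R) : 'cV[R]_s := \col_j y ^+ hexp j.

Definition gvec (u : 'cV[R]_d) : 'cV[R]_k :=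
  \col_j \prod_(l < d) u l 0 ^+ fexp j l.

Definition jac_gvec (u : 'cV[R]_d) : 'M[R]_(k, d) :=
  \matrix_(j, l) pderive (fun v => gvec v j 0) u l.

Definition hobs z : 'cV[R]_s := hvec z.2.
Definition gobs phi z : 'cV[R]_k := gvec ((eta_mx hdp phi)^T *m xvec z).
Definition jac_gobs phi z : 'M[R]_(k, d) :=
  jac_gvec ((eta_mx hdp phi)^T *m xvec z).

Definition R1 F : 'M[R]_(p, s) := mean F (fun z => xvec z *m (hobs z)^T).
Definition R2 phi F : 'M[R]_(p, k) :=
  mean F (fun z => xvec z *m (gobs phi z)^T).
Definition R3 phi F : 'M[R]_k :=
  mean F (fun z => gobs phi z *m (gobs phi z)^T).
Definition R4 phi F : 'M[R]_(k, s) :=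
  mean F (fun z => gobs phi z *m (hobs z)^T).
Definition R5 F : 'M[R]_s := mean F (fun z => hobs z *m (hobs z)^T).

Definition Rmx phi F : 'M[R]_(p, s) :=
  R1 F - R2 phi F *m invmx (R3 phi F) *m R4 phi F.

Definition ell phi F : R :=
  \tr (Rmx phi F *m invmx (R5 F) *m (Rmx phi F)^T).

Definition grad_ell phi F : 'cV[R]_(nang p d) :=
  \col_t pderive (fun psi => ell psi F) phi t.

Definition hess_ell phi F : 'M[R]_(nang p d) :=
  \matrix_(t, u) pderive (fun psi => grad_ell psi F u 0) phi t.

Definition moments_exist F : Prop :=
  [/\ mx_integrable F (fun z => xvec z *m (hobs z)^T),
      forall phi, mx_integrable F (fun z => xvec z *m (gobs phi z)^T),
      forall phi, mx_integrable F (fun z => gobs phi z *m (gobs phi z)^T),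
      forall phi, mx_integrable F (fun z => gobs phi z *m (hobs z)^T) &
      mx_integrable F (fun z => hobs z *m (hobs z)^T)].

Definition derivative_moments_exist phi F : Prop :=
  forall t,
  [/\ mx_integrable F (fun z =>
        xvec z *m (xvec z)^T *m deta_mx hdp phi t *m (jac_gobs phi z)^T),
      mx_integrable F (fun z =>
        jac_gobs phi z *m (deta_mx hdp phi t)^T *m xvec z *m (gobs phi z)^T),
      mx_integrable F (fun z =>
        gobs phi z *m (xvec z)^T *m deta_mx hdp phi t *m (jac_gobs phi z)^T) &
      mx_integrable F (fun z =>
        jac_gobs phi z *m (deta_mx hdp phi t)^T *m xvec z *m (hobs z)^T)].

(* the matrix inverses in ell (., F) exist on the whole of Omega_phi *)
Definition inverses_exist F : Prop :=
  R5 F \in unitmx /\ forall phi, Omega_phi phi -> R3 phi F \in unitmx.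

Definition is_minimizer F phi : Prop :=
  [/\ Omega_phi phi, forall psi, Omega_phi psi -> ell phi F <= ell psi F &
      grad_ell phi F = 0].

Definition rho F (y y' : R) : R :=
  ((hvec y)^T *m invmx (R5 F) *m hvec y') 0 0.

Definition reduced q (beta : 'M[R]_(p, q)) z : q.-tuple R :=
  [tuple (beta^T *m xvec z) j 0 | j < q].

(* Under F \x F on pairs w = ((X, Y), (X~, Y~)), Y~ has the distribution of Y
   and is independent of (X, Y).  The functions m i, e i and e' i represent
   E(X_i | beta^T X), E[X_i rho(Y, Y~) | Y~] and
   E[E(X_i | beta^T X) rho(Y, Y~) | Y~]. *)
Definition spans_solution F q (beta : 'M[R]_(p, q)) : Prop :=
  exists (m : 'I_p -> q.-tuple R -> R) (e e' : 'I_p -> R -> R),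
  forall i,
  [/\ cond_exp F (fun z => xvec z i 0) (reduced beta) (m i),
      cond_exp (F \x F)%E (fun w => xvec w.1 i 0 * rho F w.1.2 w.2.2)
        (fun w => w.2.2) (e i),
      cond_exp (F \x F)%E (fun w => m i (reduced beta w.1) * rho F w.1.2 w.2.2)
        (fun w => w.2.2) (e' i) &
      {ae F, forall z, e i z.2 = e' i z.2}].

Definition solution_space F (S : set 'cV[R]_p) : Prop :=
  exists q (beta : 'M[R]_(p, q)), spans_solution F beta /\ S = col_span beta.

Definition central_solution_space F : set 'cV[R]_p :=
  \bigcap_(S in solution_space F) S.

Definition model_assumption F phi : Prop :=
  [/\ solution_space F (central_solution_space F),
      central_solution_space F = col_span (eta_mx hdp phi),
      \rank (eta_mx hdp phi) = d &
      exists C : 'M[R]_(p, k), forall i,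
        cond_exp F (fun z => xvec z i 0) (reduced (eta_mx hdp phi))
          (fun u => (C *m gvec (\col_l tnth u l)) i 0)].

End Objective.

(* Main.v *)
Require Import Defs.
From HB Require Import structures.
From mathcomp Require Import all_boot all_order all_algebra.
From mathcomp Require Import all_classical all_reals all_analysis.
From mathcomp Require Import measurable_realfun.
From mathcomp Require Import ring lra.

Set Implicit Arguments.
Unset Strict Implicit.
Unset Printing Implicit Defensive.

Import Order.TTheory GRing.Theory Num.Theory.
Import numFieldNormedType.Exports.

Local Open Scope classical_set_scope.
Local Open Scope ring_scope.

(** Let [R] be the residual moment matrix, so that the objective is
[ell = tr (R R5^-1 R^T)].  The theorem rests on one fact: under the model,
[R(phi0, F0) = 0].  Indeed, the conditional mean of [X] given [eta^T X] is
[C G] for some matrix [C].  The error [V = X - C G] is orthogonal to [G], so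
[R2 = C R3] ([regression_moment]); and the solution space condition states that
[E(V H^T) R5^-1 H(Y)] vanishes, so [R1 = C R4] ([solution_moment]).

The gradient of [ell] is [2 tr ((d_t R) R5^-1 R^T)].  Because its last factor
vanishes at [(phi0, F0)], its slope along any curve of angles and distributions
through that point is [2 tr ((d_t R) R5^-1 R'^T)], where [R'] is the slope of
[R] along the curve ([grad_loss_jet]).  Three curves are used.  The coordinate
lines in [phi] give the Hessian [W] ([hess_ell_model]).  The mixtures
[(1 - alpha) F0 + alpha F] at fixed angles give [E_F g*], for every [F] in the
class ([grad_mixture_slope]).  The mixtures together with their minimizers
[phi((1 - alpha) F0 + alpha F)] give zero, by the first-order condition
([stationary_path_slope]); the inverses exist along the mixtures because the
matrices are positive semidefinite and those at [F0] are definite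
([mix_unitmx]).  Hence [W E_F phi* = - E_F g*] for every [F] in the class.

Taking for [F] an empirical distribution gives the exact identity
[W E_n phi* = - E_n g*], for every sample.  Since [P_W = W^+ W] with [W^+] the
Moore-Penrose inverse ([orth_proj_moore_penrose]), applying [P_W] to the
asymptotic linearity of [phi] gives the expansion.  Taking for [F] the point
mass at one observation turns [E_F g*] into the value of [g*] there, which is
the explicit formula for [g*] ([ae_of_sample]).

The moments are smooth in the angles because each integrand is a polynomial in
their sines and cosines whose coefficients are functions of the observation.
Integrability is assumed only for the integrands as a whole; writing them as
combinations of their own values at finitely many angles
([separable_expansion]) makes each moment a trigonometric polynomial and
justifies differentiation under the integral sign ([trig_moment]).  Derivatives
are taken along curves, as first-order expansions at 0 ([jet]), so that
two-sided partial derivatives and one-sided derivatives along mixtures are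
treated alike. *)

(** * Derivatives along curves of matrices *)

Section Jets.
Context {R : realType}.

Context (Fl : set_system R).

(** First-order behaviour of a curve at 0 along a filter: value [a], slope [l].
The value is a parameter, not [f 0], because the curves of interest (functionals
evaluated at mixtures) are known only for small positive weights.  With
[Fl := 0^'] this is a two-sided derivative, with [Fl := 0^'+] the one-sided
derivative in which influence functions are expressed. *)
Definition jet (f : R -> R) (a l : R) : Prop :=
  h^-1 * (f h - a) @[h --> Fl] --> l.

Definition mjet k l (M : R -> 'M[R]_(k, l)) (A L : 'M[R]_(k, l)) : Prop :=
  forall i j, jet (fun h => M h i j) (A i j) (L i j).

Definition mcvg k l (M : R -> 'M[R]_(k, l)) (A : 'M[R]_(k, l)) : Prop :=
  forall i j, M h i j @[h --> Fl] --> A i j.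

Context {FF : ProperFilter Fl} (Fl0 : (0 : R)^' `<=` Fl).

Let Fl_neq0 : \forall h \near Fl, h != 0.
Proof. by apply: Fl0; exact: withinT. Qed.

Let Fl_id : h @[h --> Fl] --> (0 : R).
Proof. by move=> A /nbhs_dnbhs /Fl0. Qed.

Lemma eq_jet f g a l : (\forall h \near Fl, f h = g h) -> jet f a l -> jet g a l.
Proof.
move=> fg; rewrite /jet. apply: cvg_trans. apply: near_eq_cvg.
by near=> h => /=; congr (_ * (_ - _)); near: h.
Unshelve. all: by end_near. Qed.

Lemma jet_cst a : jet (fun=> a) a 0.
Proof.
rewrite /jet (_ : (fun _ => _) = cst 0); first exact: cvg_cst.
by apply/funext => h; rewrite subrr mulr0.
Qed.

Lemma jet_id : jet id 0 1.
Proof.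
apply: (@cvg_trans _ (cst 1 @ Fl)); last exact: cvg_cst.
apply: near_eq_cvg; near=> h; rewrite /= subr0 mulVf//.
by near: h.
Unshelve. all: by end_near. Qed.

Lemma jet_cvg f a l : jet f a l -> f h @[h --> Fl] --> a.
Proof.
move=> fal; have : a + h * (h^-1 * (f h - a)) @[h --> Fl] --> a + 0 * l.
  by apply: cvgD; [exact: cvg_cst|exact: cvgM].
rewrite mul0r addr0; apply: cvg_trans; apply: near_eq_cvg; near=> h.
by rewrite mulVKf ?subrKC//; near: h.
Unshelve. all: by end_near. Qed.

Lemma jetD f g a b l m : jet f a l -> jet g b m ->
  jet (fun h => f h + g h) (a + b) (l + m).
Proof.
move=> fa gb; rewrite /jet.
rewrite (_ : (fun _ => _) = fun h => h^-1 * (f h - a) + h^-1 * (g h - b)).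
  exact: cvgD.
by apply/funext => h; rewrite -mulrDr opprD addrACA.
Qed.

Lemma jetM f g a b l m : jet f a l -> jet g b m ->
  jet (fun h => f h * g h) (a * b) (l * b + a * m).
Proof.
move=> fa gb; rewrite /jet.
rewrite (_ : (fun _ => _) =
    fun h => h^-1 * (f h - a) * g h + a * (h^-1 * (g h - b))).
  apply: cvgD; last by apply: cvgM => //; exact: cvg_cst.
  by apply: cvgM => //; exact: jet_cvg gb.
by apply/funext => h; ring.
Qed.

Lemma jetZ c f a l : jet f a l -> jet (fun h => c * f h) (c * a) (c * l).
Proof.
move=> fa; have := jetM (jet_cst c) fa.
by rewrite mul0r add0r.
Qed.

Lemma jetN f a l : jet f a l -> jet (fun h => - f h) (- a) (- l).
Proof.
move=> /(jetZ (c := -1)); rewrite !mulN1r.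
by apply: eq_jet; near=> h; rewrite mulN1r.
Unshelve. all: by end_near. Qed.

Lemma jetB f g a b l m : jet f a l -> jet g b m ->
  jet (fun h => f h - g h) (a - b) (l - m).
Proof. by move=> fa /jetN; exact: jetD. Qed.

Lemma jet_sum (I : Type) (r : seq I) (f : I -> R -> R) (a l : I -> R) :
  (forall i, jet (f i) (a i) (l i)) ->
  jet (fun h => \sum_(i <- r) f i h) (\sum_(i <- r) a i) (\sum_(i <- r) l i).
Proof.
move=> fal; elim: r => [|i r IHr].
  rewrite !big_nil; apply: eq_jet (jet_cst 0).
  by near=> h; rewrite big_nil.
rewrite !big_cons; apply: eq_jet (jetD (fal i) IHr).
by near=> h; rewrite big_cons.
Unshelve. all: by end_near. Qed.

Lemma jetX f a l n : jet f a l ->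
  jet (fun h => f h ^+ n) (a ^+ n) (n%:R * a ^+ n.-1 * l).
Proof.
move=> fal; elim: n => [|n IHn]; first by rewrite !mul0r; exact: jet_cst.
rewrite exprS (_ : _ * l = l * a ^+ n + a * (n%:R * a ^+ n.-1 * l)).
  by apply: eq_jet (jetM fal IHn); near=> h; rewrite exprS.
case: n {IHn} => [|n] /=; first by rewrite !expr0; ring.
by rewrite exprS -[n.+2%:R]natr1; ring.
Unshelve. all: by end_near. Qed.

(** The difference quotient of [f] at [x], completed by [df] at [x], is
continuous at [x]; hence the chain rule holds even when the curve returns to
[x] infinitely often. *)
Lemma jet_comp (f c : R -> R) (x l df : R) : is_derive x (1 : R) f df ->
  jet c x l -> jet (f \o c) (f x) (df * l).
Proof.
move=> [fdrv fE] cxl.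
pose q y := if y == x then df else (y - x)^-1 * (f y - f x).
have q_cvg : q y @[y --> x] --> df.
  apply/cvgrPdist_lt => e e0.
  have := fdrv; rewrite /derivable => /cvg_lim.
  have dq : h^-1 *: (f (h + x) - f x) @[h --> 0^'] --> df.
    rewrite -fE /derive.
    rewrite (_ : (fun h : R => _) =
       (fun h => h^-1 *: ((f \o shift x) h%:A - f x))) //.
    by apply/funext => h /=; rewrite [h%:A]mulr1.
  move=> _; have /cvgrPdist_lt/(_ e e0) := dq.
  rewrite near_withinE => /nbhs_ballP[d /= d0 dP].
  apply/nbhs_ballP; exists d => //= y xy; rewrite /q.
  case: eqVneq => [_|yx]; first by rewrite subrr normr0.
  have := dP (y - x); rewrite /= subrK => dPy; apply: dPy; last by rewrite subr_eq0.
  by rewrite /ball /= sub0r opprB.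
have qc : q (c h) @[h --> Fl] --> df.
  exact: (cvg_comp c q (jet_cvg cxl) q_cvg).
have qcl : q (c h) * (h^-1 * (c h - x)) @[h --> Fl] --> df * l.
  exact: cvgM.
rewrite /jet; apply: cvg_trans qcl.
apply: near_eq_cvg; near=> h => /=.
rewrite /q; case: eqVneq => [->|cx]; first by rewrite !subrr !mulr0.
by rewrite mulrCA [(_ - _)^-1 * _]mulrC mulfVK// subr_eq0.
Unshelve. all: by end_near. Qed.

Lemma jet_cos (c : R -> R) x l : jet c x l ->
  jet (fun h => cos (c h)) (cos x) (- sin x * l).
Proof. by move=> cxl; apply: jet_comp cxl; exact: is_derive_cos. Qed.

Lemma jet_sin (c : R -> R) x l : jet c x l ->
  jet (fun h => sin (c h)) (sin x) (cos x * l).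
Proof. by move=> cxl; apply: jet_comp cxl; exact: is_derive_sin. Qed.

(** Leibniz rule for finite products, in the form in which the terms can be
matched with partial derivatives of monomials. *)
Lemma jet_prod n (f : 'I_n -> R -> R) (a l : 'I_n -> R) :
  (forall i, jet (f i) (a i) (l i)) ->
  jet (fun h => \prod_(i < n) f i h) (\prod_(i < n) a i)
      (\sum_(i < n) l i * \prod_(j < n | j != i) a j).
Proof.
elim: n f a l => [|n IHn] f a l fal.
  rewrite !big_ord0; apply: eq_jet (jet_cst 1).
  by near=> h; rewrite big_ord0.
have lE : \sum_(i < n.+1) l i * \prod_(j < n.+1 | j != i) a j =
    l ord0 * \prod_(i < n) a (lift ord0 i) + a ord0 *
    \sum_(i < n) l (lift ord0 i) * \prod_(j < n | j != i) a (lift ord0 j).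
  rewrite big_ord_recl mulr_sumr [X in _ * X + _]big_mkcond big_ord_recl /= mul1r.
  congr (_ * _ + _); apply: eq_bigr => i _.
  rewrite big_mkcond big_ord_recl /= mulrCA -big_mkcond /=.
  by congr (_ * (_ * _)); apply: eq_bigl => j; rewrite (inj_eq (@lift_inj _ _)).
rewrite lE big_ord_recl.
apply: eq_jet (jetM (fal ord0) (IHn _ _ _ (fun i => fal (lift ord0 i)))).
by near=> h; rewrite big_ord_recl.
Unshelve. all: by end_near. Qed.

Lemma eq_mjet k l (M N : R -> 'M[R]_(k, l)) A L :
  (\forall h \near Fl, M h = N h) -> mjet M A L -> mjet N A L.
Proof.
move=> MN MAL i j; apply: eq_jet (MAL i j).
by near=> h; congr (fun_of_matrix _ i j); near: h.
Unshelve. all: by end_near. Qed.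

Lemma mjet_cst k l (A : 'M[R]_(k, l)) : mjet (fun=> A) A 0.
Proof. by move=> i j; rewrite mxE; exact: jet_cst. Qed.

Lemma mjetD k l (M N : R -> 'M[R]_(k, l)) A B L K :
  mjet M A L -> mjet N B K -> mjet (fun h => M h + N h) (A + B) (L + K).
Proof.
move=> MA NB i j; rewrite !mxE; apply: eq_jet (jetD (MA i j) (NB i j)).
by near=> h; rewrite mxE.
Unshelve. all: by end_near. Qed.

Lemma mjetZ k l (c : R -> R) (M : R -> 'M[R]_(k, l)) a b A L :
  jet c a b -> mjet M A L ->
  mjet (fun h => c h *: M h) (a *: A) (b *: A + a *: L).
Proof.
move=> ca MA i j; rewrite !mxE; apply: eq_jet (jetM ca (MA i j)).
by near=> h; rewrite mxE.
Unshelve. all: by end_near. Qed.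

Lemma mjetZl k l c (M : R -> 'M[R]_(k, l)) A L :
  mjet M A L -> mjet (fun h => c *: M h) (c *: A) (c *: L).
Proof. by move=> /(mjetZ (jet_cst c)); rewrite scale0r add0r. Qed.

Lemma mjetN k l (M : R -> 'M[R]_(k, l)) A L :
  mjet M A L -> mjet (fun h => - M h) (- A) (- L).
Proof.
move=> MA i j; rewrite !mxE; apply: eq_jet (jetN (MA i j)).
by near=> h; rewrite mxE.
Unshelve. all: by end_near. Qed.

Lemma mjetB k l (M N : R -> 'M[R]_(k, l)) A B L K :
  mjet M A L -> mjet N B K -> mjet (fun h => M h - N h) (A - B) (L - K).
Proof. by move=> MA /mjetN; exact: mjetD. Qed.

Lemma mjet_tr k l (M : R -> 'M[R]_(k, l)) A L :
  mjet M A L -> mjet (fun h => (M h)^T) A^T L^T.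
Proof.
move=> MA i j; rewrite !mxE; apply: eq_jet (MA j i).
by near=> h; rewrite mxE.
Unshelve. all: by end_near. Qed.

Lemma mjetM k l n (M : R -> 'M[R]_(k, l)) (N : R -> 'M[R]_(l, n)) A B L K :
  mjet M A L -> mjet N B K ->
  mjet (fun h => M h *m N h) (A *m B) (L *m B + A *m K).
Proof.
move=> MA NB i j; rewrite !mxE -big_split /=.
apply: eq_jet; last first.
  by apply: jet_sum => r; exact: jetM (MA i r) (NB r j).
by near=> h; rewrite mxE.
Unshelve. all: by end_near. Qed.

Lemma jet_trace n (M : R -> 'M[R]_n) A L :
  mjet M A L -> jet (fun h => \tr (M h)) (\tr A) (\tr L).
Proof. by move=> MA; apply: jet_sum => i; exact: MA. Qed.

Lemma mjet_mcvg k l (M : R -> 'M[R]_(k, l)) A L : mjet M A L -> mcvg M A.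
Proof. by move=> MA i j; exact: jet_cvg (MA i j). Qed.

Lemma cvg_bigsum (I : Type) (r : seq I) (P : pred I) (f : I -> R -> R)
    (a : I -> R) :
  (forall i, f i h @[h --> Fl] --> a i) ->
  \sum_(i <- r | P i) f i h @[h --> Fl] --> \sum_(i <- r | P i) a i.
Proof.
move=> fa; elim: r => [|i r IHr].
  rewrite big_nil; under eq_fun do rewrite big_nil.
  exact: cvg_cst.
rewrite big_cons; under eq_fun do rewrite big_cons.
by case: ifP => _ //; apply: cvgD.
Qed.

Lemma cvg_bigprod (I : Type) (r : seq I) (P : pred I) (f : I -> R -> R)
    (a : I -> R) :
  (forall i, f i h @[h --> Fl] --> a i) ->
  \prod_(i <- r | P i) f i h @[h --> Fl] --> \prod_(i <- r | P i) a i.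
Proof.
move=> fa; elim: r => [|i r IHr].
  rewrite big_nil; under eq_fun do rewrite big_nil.
  exact: cvg_cst.
rewrite big_cons; under eq_fun do rewrite big_cons.
by case: ifP => _ //; apply: cvgM.
Qed.

Lemma mcvgM k l n (M : R -> 'M[R]_(k, l)) (N : R -> 'M[R]_(l, n)) A B :
  mcvg M A -> mcvg N B -> mcvg (fun h => M h *m N h) (A *m B).
Proof.
move=> MA NB i j; rewrite mxE; under eq_fun do rewrite mxE.
by apply: cvg_bigsum => r; exact: cvgM.
Qed.

Lemma mcvgN k l (M : R -> 'M[R]_(k, l)) A :
  mcvg M A -> mcvg (fun h => - M h) (- A).
Proof.
move=> MA i j; rewrite mxE; under eq_fun do rewrite mxE.
by apply: cvgN; exact: MA.
Qed.

Lemma mcvgD k l (M N : R -> 'M[R]_(k, l)) A B :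
  mcvg M A -> mcvg N B -> mcvg (fun h => M h + N h) (A + B).
Proof.
move=> MA NB i j; rewrite mxE; under eq_fun do rewrite mxE.
by apply: cvgD; [exact: MA|exact: NB].
Qed.

Lemma cvg_det n (M : R -> 'M[R]_n) A :
  mcvg M A -> \det (M h) @[h --> Fl] --> \det A.
Proof.
move=> MA; apply: cvg_bigsum => s; apply: cvgM; first exact: cvg_cst.
by apply: cvg_bigprod => i; exact: MA.
Qed.

Lemma near_unitmx n (M : R -> 'M[R]_n) A : A \in unitmx -> mcvg M A ->
  \forall h \near Fl, M h \in unitmx.
Proof.
rewrite unitmxE unitfE => A0 /cvg_det MA.
have /cvgrPdist_lt/(_ `|\det A|) := MA; rewrite normr_gt0 => /(_ A0).
apply: filterS => h; rewrite unitmxE unitfE.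
by apply: contraTN => /eqP ->; rewrite subr0 ltxx.
Qed.

(** Cramer's rule expresses the inverse by determinants, which are
polynomials in the entries. *)
Lemma mcvg_inv n (M : R -> 'M[R]_n) A : A \in unitmx -> mcvg M A ->
  mcvg (fun h => invmx (M h)) (invmx A).
Proof.
move=> Au MA i j.
have adjE : (\det (M h))^-1 * (\adj (M h)) i j @[h --> Fl] --> invmx A i j.
  rewrite /invmx Au mxE; apply: cvgM.
    apply: cvgV; last exact: cvg_det.
    by move: Au; rewrite unitmxE unitfE.
  rewrite mxE; under eq_fun do rewrite mxE.
  apply: cvgM; first exact: cvg_cst.
  apply: cvg_det => a b; rewrite !mxE; under eq_fun do rewrite !mxE.
  exact: MA.
apply: cvg_trans adjE; apply: near_eq_cvg.
near=> h; rewrite /invmx ifT ?mxE//; near: h.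
exact: near_unitmx MA.
Unshelve. all: by end_near. Qed.

(** From [M^-1 - A^-1 = - M^-1 (M - A) A^-1] and the continuity of the
inverse. *)
Lemma mjet_inv n (M : R -> 'M[R]_n) A L : A \in unitmx -> mjet M A L ->
  mjet (fun h => invmx (M h)) (invmx A) (- (invmx A *m L *m invmx A)).
Proof.
move=> Au MA i j.
have quo : mcvg (fun h => - (invmx (M h) *m (h^-1 *: (M h - A)) *m invmx A))
    (- (invmx A *m L *m invmx A)).
  apply: mcvgN; apply: mcvgM; last by move=> a b; exact: cvg_cst.
  apply: mcvgM; first exact: mcvg_inv (mjet_mcvg MA).
  by move=> a b; under eq_fun do rewrite !mxE; exact: MA.
apply: cvg_trans (quo i j); apply: near_eq_cvg; near=> h => /=.
have Mu : M h \in unitmx by near: h; exact: near_unitmx (mjet_mcvg MA).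
rewrite -scalemxAr -scalemxAl mulmxBr mulmxBl mulVmx// mul1mx.
by rewrite -mulmxA mulmxV// mulmx1 -scalerN opprB !mxE.
Unshelve. all: by end_near. Qed.

(** Leibniz rule for an ordered product of matrices: each factor is
differentiated in its place. *)
Lemma mjet_bigmul (I : eqType) (r : seq I) n (M : I -> R -> 'M[R]_n)
    (A L : I -> 'M[R]_n) : uniq r -> (forall i, mjet (M i) (A i) (L i)) ->
  mjet (fun h => \big[mulmx/1%:M]_(i <- r) M i h)
    (\big[mulmx/1%:M]_(i <- r) A i)
    (\sum_(t <- r) \big[mulmx/1%:M]_(i <- r) (if i == t then L i else A i)).
Proof.
move=> + MAL; elim: r => [_|i r IHr /= /andP[ir /IHr {}IHr]].
  rewrite !big_nil; apply: eq_mjet (mjet_cst _).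
  by near=> h; rewrite big_nil.
rewrite big_cons [X in mjet _ _ X]big_cons big_cons eqxx.
have -> : \big[mulmx/1%:M]_(j <- r) (if j == i then L j else A j) =
    \big[mulmx/1%:M]_(j <- r) A j.
  by apply: eq_big_seq => j jr; case: eqP jr ir => // -> ->.
have -> : \sum_(t <- r) \big[mulmx/1%:M]_(j <- i :: r)
      (if j == t then L j else A j) =
    A i *m \sum_(t <- r) \big[mulmx/1%:M]_(j <- r)
      (if j == t then L j else A j).
  rewrite mulmx_sumr; apply: eq_big_seq => t tr; rewrite big_cons.
  by case: eqP tr ir => // -> ->.
apply: eq_mjet (mjetM (MAL i) IHr).
by near=> h; rewrite big_cons.
Unshelve. all: by end_near. Qed.
End Jets.

(** * Trigonometric polynomials in the rotation angles *)

Section DirectionalJets.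
Context {R : realType}.

Lemma sub_dnbhs0 : (0 : R)^' `<=` 0^'.
Proof. by []. Qed.

Lemma jet_pderive n (f : 'cV[R]_n -> R) x t l :
  jet 0^' (fun h => f (x + h *: delta_mx t 0)) (f x) l -> pderive f x t = l.
Proof.
move=> fl; rewrite /pderive /derive1; apply: cvg_lim => //.
by under eq_fun do rewrite addr0 scale0r addr0.
Qed.

Lemma jet_line n (x : 'cV[R]_n) t u :
  jet 0^' (fun h => (x + h *: delta_mx t 0) u 0) (x u 0)
    ((delta_mx t 0 : 'cV[R]_n) u 0).
Proof.
under eq_fun do rewrite mxE [X in _ + X]mxE.
set dtu := delta_mx t 0 u 0.
have : jet 0^' (fun h => x u 0 + h * dtu) (x u 0 + 0 * dtu)
    (0 + (1 * dtu + 0 * 0)).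
  apply: jetD; first exact: jet_cst.
  by apply: jetM; [exact: sub_dnbhs0|exact: jet_id|exact: jet_cst].
by rewrite mulr0 mul0r !addr0 mul1r add0r.
Qed.

Lemma mjet_pderive n k l (M : 'cV[R]_n -> 'M[R]_(k, l)) x t L :
  mjet 0^' (fun h => M (x + h *: delta_mx t 0)) (M x) L ->
  pderive_mx M x t = L.
Proof. by move=> ML; apply/matrixP => i j; rewrite mxE; exact: jet_pderive. Qed.

End DirectionalJets.

Section TrigonometricPolynomials.
Context {R : realType} {m : nat}.

Lemma sum_delta_mx k l t (A : 'I_m -> 'M[R]_(k, l)) :
  \sum_u (delta_mx t 0 : 'cV[R]_m) u 0 *: A u = A t.
Proof.
rewrite (bigD1 t)//= mxE !eqxx scale1r big1 ?addr0// => u ut.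
by rewrite mxE (negbTE ut) scale0r.
Qed.

Lemma sum_delta t (f : 'I_m -> R) :
  \sum_u (delta_mx t 0 : 'cV[R]_m) u 0 * f u = f t.
Proof.
rewrite (bigD1 t)//= mxE !eqxx mul1r big1 ?addr0// => u ut.
by rewrite mxE (negbTE ut) mul0r.
Qed.

(** Syntax for polynomials in the sines and cosines of the angles.  A syntax,
rather than a class of smooth functions, gives the partial derivatives by
recursion, again inside the class, so that the chain rule along curves and the
continuity of the partial derivatives follow by induction. *)
Inductive texp : Type :=
  | TConst of R
  | TCos of 'I_m
  | TSin of 'I_m
  | TAdd of texp & texp
  | TMul of texp & texp.

Fixpoint teval (e : texp) (x : 'cV[R]_m) : R :=
  match e with
  | TConst r => r
  | TCos t => cos (x t 0)
  | TSin t => sin (x t 0)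
  | TAdd e1 e2 => teval e1 x + teval e2 x
  | TMul e1 e2 => teval e1 x * teval e2 x
  end.

Fixpoint tder (t : 'I_m) (e : texp) : texp :=
  match e with
  | TConst r => TConst 0
  | TCos u => TMul (TConst (- (u == t)%:R)) (TSin u)
  | TSin u => TMul (TConst (u == t)%:R) (TCos u)
  | TAdd e1 e2 => TAdd (tder t e1) (tder t e2)
  | TMul e1 e2 => TAdd (TMul (tder t e1) e2) (TMul e1 (tder t e2))
  end.

Definition trig (f : 'cV[R]_m -> R) : Prop := exists e, f = teval e.

Definition curve_jet (Fl : set_system R) (c : R -> 'cV[R]_m)
    (x v : 'cV[R]_m) : Prop := forall t, jet Fl (fun h => c h t 0) (x t 0) (v t 0).

Lemma curve_jet_line (x : 'cV[R]_m) t :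
  curve_jet 0^' (fun h => x + h *: delta_mx t 0) x (delta_mx t 0).
Proof. by move=> u; exact: jet_line. Qed.


Let teval_jet (Fl : set_system R) {FF : ProperFilter Fl}
    (Fl0 : (0 : R)^' `<=` Fl) c x v e : curve_jet Fl c x v ->
  jet Fl (fun h => teval e (c h)) (teval e x)
    (\sum_t v t 0 * teval (tder t e) x).
Proof.
move=> cxv; elim: e => [r|u|u|e1 IH1 e2 IH2|e1 IH1 e2 IH2] /=.
- by rewrite big1 => [|t _]; [exact: jet_cst|rewrite mulr0].
- rewrite (bigD1 u)//= eqxx big1 => [|t tu]; last first.
    by rewrite eq_sym (negbTE tu) oppr0 mul0r mulr0.
  by rewrite addr0 mulN1r mulrC; exact: jet_cos.
- rewrite (bigD1 u)//= eqxx big1 => [|t tu]; last first.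
    by rewrite eq_sym (negbTE tu) mul0r mulr0.
  by rewrite addr0 mul1r mulrC; exact: jet_sin.
- under eq_bigr do rewrite mulrDr.
  by rewrite big_split; exact: jetD.
- under eq_bigr do rewrite mulrDr [teval e1 x * _]mulrC !mulrA.
  by rewrite big_split /= -!mulr_suml [_ * teval e1 x]mulrC; exact: jetM.
Qed.

Let pderive_teval e x t : pderive (teval e) x t = teval (tder t e) x.
Proof.
apply: jet_pderive.
rewrite -(sum_delta t (fun u => teval (tder u e) x)).
by apply: teval_jet => //; exact: curve_jet_line.
Qed.

(** The chain rule, in which the angles follow a curve that is only assumed to
have a first-order expansion at 0. *)
Lemma trig_jet (Fl : set_system R) {FF : ProperFilter Fl}
    (Fl0 : (0 : R)^' `<=` Fl) c x v f : trig f -> curve_jet Fl c x v ->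
  jet Fl (fun h => f (c h)) (f x) (\sum_t v t 0 * pderive f x t).
Proof.
move=> [e ->] cxv; under eq_bigr do rewrite pderive_teval.
exact: teval_jet.
Qed.

Lemma trig_pderive f t : trig f -> trig (fun x => pderive f x t).
Proof.
by move=> [e ->]; exists (tder t e); apply/funext => x; rewrite pderive_teval.
Qed.

Lemma trig_cst a : trig (fun=> a).
Proof. by exists (TConst a). Qed.

Lemma trig_cos t : trig (fun x => cos (x t 0)).
Proof. by exists (TCos t). Qed.

Lemma trig_sin t : trig (fun x => sin (x t 0)).
Proof. by exists (TSin t). Qed.

Lemma trigD f g : trig f -> trig g -> trig (fun x => f x + g x).
Proof. by move=> [e ->] [e' ->]; exists (TAdd e e'). Qed.

Lemma trigM f g : trig f -> trig g -> trig (fun x => f x * g x).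
Proof. by move=> [e ->] [e' ->]; exists (TMul e e'). Qed.

Lemma trig_sum (I : Type) (r : seq I) (f : I -> 'cV[R]_m -> R) :
  (forall i, trig (f i)) -> trig (fun x => \sum_(i <- r) f i x).
Proof.
move=> tf; elim: r => [|i r IHr].
  by under eq_fun do rewrite big_nil; exact: trig_cst.
by under eq_fun do rewrite big_cons; exact: trigD.
Qed.

Definition trigmx k l (A : 'cV[R]_m -> 'M[R]_(k, l)) : Prop :=
  forall i j, trig (fun x => A x i j).

Lemma trigmx_jet (Fl : set_system R) {FF : ProperFilter Fl}
    (Fl0 : (0 : R)^' `<=` Fl) c x v k l (A : 'cV[R]_m -> 'M[R]_(k, l)) :
  trigmx A -> curve_jet Fl c x v ->
  mjet Fl (fun h => A (c h)) (A x) (\sum_t v t 0 *: pderive_mx A x t).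
Proof.
move=> tA cxv i j; rewrite summxE.
under eq_bigr do rewrite !mxE.
exact: (trig_jet Fl0 (tA i j) cxv).
Qed.

Lemma trigmx_pderive k l (A : 'cV[R]_m -> 'M[R]_(k, l)) t : trigmx A ->
  trigmx (fun x => pderive_mx A x t).
Proof.
move=> tA i j; under eq_fun do rewrite mxE.
exact: trig_pderive.
Qed.

Lemma trigmx_cst k l (A : 'M[R]_(k, l)) : trigmx (fun=> A).
Proof. by move=> i j; exact: trig_cst. Qed.

Lemma trigmxD k l (A B : 'cV[R]_m -> 'M[R]_(k, l)) :
  trigmx A -> trigmx B -> trigmx (fun x => A x + B x).
Proof.
by move=> tA tB i j; under eq_fun do rewrite mxE; exact: trigD.
Qed.

Lemma trigmxZ c k l (A : 'cV[R]_m -> 'M[R]_(k, l)) :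
  trigmx A -> trigmx (fun x => c *: A x).
Proof.
move=> tA i j; under eq_fun do rewrite mxE.
by apply: trigM => //; exact: trig_cst.
Qed.

Lemma trigmxM k l n (A : 'cV[R]_m -> 'M[R]_(k, l)) (B : 'cV[R]_m -> 'M[R]_(l, n)) :
  trigmx A -> trigmx B -> trigmx (fun x => A x *m B x).
Proof.
move=> tA tB i j; under eq_fun do rewrite mxE.
by apply: trig_sum => r; exact: trigM.
Qed.

Lemma trigmx_bigmul (I : Type) (r : seq I) n (A : I -> 'cV[R]_m -> 'M[R]_n) :
  (forall i, trigmx (A i)) ->
  trigmx (fun x => \big[mulmx/1%:M]_(i <- r) A i x).
Proof.
move=> tA; elim: r => [|i r IHr].
  by under eq_fun do rewrite big_nil; exact: trigmx_cst.
by under eq_fun do rewrite big_cons; exact: trigmxM.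
Qed.

Lemma mjet_line k l (A : 'cV[R]_m -> 'M[R]_(k, l)) x t : trigmx A ->
  mjet 0^' (fun h => A (x + h *: delta_mx t 0)) (A x) (pderive_mx A x t).
Proof.
move=> tA; rewrite -(sum_delta_mx t (fun u => pderive_mx A x u)).
by apply: trigmx_jet => //; exact: curve_jet_line.
Qed.

Lemma pderive_mx_comb k l (a b : R) (A B : 'cV[R]_m -> 'M[R]_(k, l)) x t :
  trigmx A -> trigmx B ->
  pderive_mx (fun y => a *: A y + b *: B y) x t =
  a *: pderive_mx A x t + b *: pderive_mx B x t.
Proof.
move=> tA tB; apply: mjet_pderive.
by apply: mjetD; apply: mjetZl => //; exact: mjet_line.
Qed.

Lemma pderive_sum_trig (I : Type) (r : seq I) (f : I -> 'cV[R]_m -> R)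
    (b : I -> R) x t : (forall i, trig (f i)) ->
  pderive (fun y => \sum_(i <- r) f i y * b i) x t =
  \sum_(i <- r) pderive (f i) x t * b i.
Proof.
move=> tf; apply: jet_pderive; apply: jet_sum => // i.
rewrite -[X in jet _ _ _ X]addr0 -[X in _ + X](mulr0 (f i x)).
apply: jetM => //; last exact: jet_cst.
rewrite -(sum_delta t (fun u => pderive (f i) x u)).
by apply: trig_jet => //; exact: curve_jet_line.
Qed.

End TrigonometricPolynomials.
Arguments texp : clear implicits.

Section SeparableFamilies.
Context {R : realType} {m : nat} {T : Type}.
Implicit Types h : 'cV[R]_m -> T -> R.

(** [h x z] is a finite sum of products of a trigonometric polynomial in [x]
and a function of [z]; every monomial in the coordinates of [eta(x)^T X] is
such a sum.  For a fixed [z] the function of [x] is smooth, and the [z]-part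
does not depend on [x]. *)
Definition separable h : Prop := exists L : seq (texp R m * (T -> R)),
  forall x z, h x z = \sum_(eq <- L) teval eq.1 x * eq.2 z.

Lemma separable_trig f : trig f -> separable (fun x _ => f x).
Proof.
move=> [e ->]; exists [:: (e, fun=> 1)] => x z.
by rewrite big_seq1 mulr1.
Qed.

Lemma separable_fun (q : T -> R) : separable (fun _ z => q z).
Proof.
by exists [:: (TConst 1, q)] => x z; rewrite big_seq1 mul1r.
Qed.

Lemma separableD h g : separable h -> separable g ->
  separable (fun x z => h x z + g x z).
Proof.
move=> [L hL] [K gK]; exists (L ++ K) => x z.
by rewrite big_cat hL gK.
Qed.

Lemma separableM h g : separable h -> separable g ->
  separable (fun x z => h x z * g x z).
Proof.
move=> [L hL] [K gK].
exists [seq (TMul a.1 b.1, fun z => a.2 z * b.2 z) | a <- L, b <- K] => x z.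
rewrite hL gK big_allpairs_dep mulr_suml; apply: eq_bigr => a _.
by rewrite mulr_sumr; apply: eq_bigr => b _ /=; ring.
Qed.

Lemma separable_sum (I : Type) (r : seq I) (h : I -> 'cV[R]_m -> T -> R) :
  (forall i, separable (h i)) ->
  separable (fun x z => \sum_(i <- r) h i x z).
Proof.
move=> sh; elim: r => [|i r [L IHr]].
  by exists [::] => x z; rewrite !big_nil.
have [K gK] := separableD (sh i) (ex_intro _ L IHr).
by exists K => x z; rewrite big_cons gK.
Qed.

Lemma separable_prod (I : Type) (r : seq I) (h : I -> 'cV[R]_m -> T -> R) :
  (forall i, separable (h i)) ->
  separable (fun x z => \prod_(i <- r) h i x z).
Proof.
move=> sh; elim: r => [|i r [L IHr]].
  have [K gK] := separable_fun (fun=> 1).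
  by exists K => x z; rewrite big_nil -gK.
have [K gK] := separableM (sh i) (ex_intro _ L IHr).
by exists K => x z; rewrite big_cons gK.
Qed.

Lemma separableX h n : separable h -> separable (fun x z => h x z ^+ n).
Proof.
move=> sh; elim: n => [|n IHn]; first exact: separable_fun.
have [K gK] := separableM sh IHn.
by exists K => x z; rewrite exprS gK.
Qed.

(** Rows chosen so that the rank is maximal: adding another row cannot
increase the rank, hence it belongs to the span. *)
Lemma finite_row_span (K : fieldType) (U : Type) n (C : U -> 'rV[K]_n) :
  exists N (pt : 'I_N -> U), forall u, (C u <= \matrix_b C (pt b))%MS.
Proof.
pose P r := `[< exists N (pt : 'I_N -> U), \rank (\matrix_b C (pt b)) = r >].
have P0 : exists r, P r.
  exists (\rank (\matrix_(b < 0) (0 : 'rV[K]_n))); apply/asboolP.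
  have pt0 (b : 'I_0) : U by case: b.
  exists 0%N, pt0; congr (\rank _); apply/matrixP => -[//].
have Pn r : P r -> (r <= n)%N.
  by move=> /asboolP[N [pt <-]]; exact: rank_leq_col.
case: (ex_maxnP P0 Pn) => r /asboolP[N [pt ptr]] rmax.
exists N, pt => u.
pose pt' (b : 'I_N.+1) := if unlift ord0 b is Some j then pt j else u.
set A := \matrix_b C (pt b); pose B := \matrix_b C (pt' b).
have AB : (A <= B)%MS.
  apply/row_subP => b; rewrite (_ : row b A = row (lift ord0 b) B) ?row_sub//.
  by rewrite !rowK /pt' liftK.
have rBA : (\rank B <= \rank A)%N.
  by rewrite ptr; apply: rmax; apply/asboolP; exists N.+1, pt'.
have uB : (C u <= B)%MS.
  rewrite (_ : C u = row ord0 B) ?row_sub//.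
  by rewrite rowK /pt' unlift_none.
apply: submx_trans uB _.
by rewrite -(geq_leqif (mxrank_leqif_sup AB)).
Qed.

(** The functions of [z] in a separable family need not be integrable when all
members of the family are.  Expanding the coefficient vector on finitely many
of its own values replaces them by members [h (pt b)] of the family. *)
Lemma separable_expansion h : separable h ->
  exists N (lam : 'I_N -> 'cV[R]_m -> R) (pt : 'I_N -> 'cV[R]_m),
  (forall b, trig (lam b)) /\
  forall x z, h x z = \sum_b lam b x * h (pt b) z.
Proof.
move=> [L hL]; pose e (a : 'I_(size L)) := (tnth (in_tuple L) a).1.
pose q (a : 'I_(size L)) := (tnth (in_tuple L) a).2.
have hE x z : h x z = \sum_a teval (e a) x * q a z.
  by rewrite hL big_tnth.
pose C x : 'rV[R]_(size L) := \row_a teval (e a) x.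
have [N [pt ptC]] := finite_row_span C.
pose K := \matrix_b C (pt b).
exists N, (fun b x => (C x *m pinvmx K) 0 b), pt; split=> [b|x z].
  under eq_fun do rewrite mxE.
  apply: trig_sum => a; apply: trigM; last exact: trig_cst.
  by under eq_fun do rewrite mxE; exists (e a).
under eq_bigr do rewrite hE mulr_sumr.
rewrite exchange_big hE; apply: eq_bigr => a _ /=.
under eq_bigr do rewrite mulrA.
rewrite -mulr_suml; congr (_ * _).
have := congr1 (fun A : 'rV[R]_(size L) => A 0 a) (mulmxKpV (ptC x)).
rewrite !mxE => <-; apply: eq_bigr => b _.
by rewrite !mxE.
Qed.

End SeparableFamilies.

(** * Means of matrices and their dependence on the angles *)

Section Integrals.
Context {R : realType} {d} {T : measurableType d} (F : {measure set T -> \bar R}).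
Local Notation integrableR f := (F.-integrable setT (EFin \o f)).

Lemma integrableR_sum (I : Type) (r : seq I) (f : I -> T -> R) :
  (forall i, integrableR (f i)) -> integrableR (fun z => \sum_(i <- r) f i z).
Proof.
move=> fi; rewrite (_ : _ \o _ = fun z => (\sum_(i <- r) (f i z)%:E)%E).
  by apply: integrable_sum => // i _; exact: fi.
by apply/funext => z; rewrite /= sumEFin.
Qed.

Lemma integrableRZl a (f : T -> R) :
  integrableR f -> integrableR (fun z => a * f z).
Proof. by move=> fi; exact: (integrableZl measurableT a fi). Qed.

Lemma integrableRD (f g : T -> R) :
  integrableR f -> integrableR g -> integrableR (fun z => f z + g z).
Proof. by move=> fi gi; exact: (integrableD measurableT fi gi). Qed.

Lemma integrableRB (f g : T -> R) :
  integrableR f -> integrableR g -> integrableR (fun z => f z - g z).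
Proof. by move=> fi gi; exact: (integrableB measurableT fi gi). Qed.

Lemma Rintegral_sum (I : Type) (r : seq I) (f : I -> T -> R) :
  (forall i, integrableR (f i)) ->
  \int[F]_z (\sum_(i <- r) f i z) = \sum_(i <- r) \int[F]_z f i z.
Proof.
move=> fi; elim: r => [|i r IHr].
  rewrite big_nil; under eq_Rintegral do rewrite big_nil.
  by rewrite Rintegral_cst// mul0r.
rewrite big_cons -IHr -RintegralD//; last exact: integrableR_sum.
by apply: eq_Rintegral => z _; rewrite big_cons.
Qed.

End Integrals.

Section MatrixMeans.
Context {R : realType} {d} {T : measurableType d} (F : probability T R).
Local Notation integrableR f := (F.-integrable setT (EFin \o f)).

Lemma integrableR_cst (a : R) : integrableR (fun=> a).
Proof. exact: finite_measure_integrable_cst. Qed.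

Lemma mx_integrable_cst k l (A : 'M[R]_(k, l)) : mx_integrable F (fun=> A).
Proof. by move=> i j; exact: integrableR_cst. Qed.

Lemma mx_integrableD k l (M N : T -> 'M[R]_(k, l)) :
  mx_integrable F M -> mx_integrable F N ->
  mx_integrable F (fun z => M z + N z).
Proof.
move=> Mi Ni i j; rewrite (_ : (fun z => _) = fun z => M z i j + N z i j).
  exact: integrableRD.
by apply/funext => z; rewrite mxE.
Qed.

Lemma mx_integrableZl k l a (M : T -> 'M[R]_(k, l)) :
  mx_integrable F M -> mx_integrable F (fun z => a *: M z).
Proof.
move=> Mi i j; rewrite (_ : (fun z => _) = fun z => a * M z i j).
  exact: integrableRZl.
by apply/funext => z; rewrite mxE.
Qed.

Lemma mx_integrableB k l (M N : T -> 'M[R]_(k, l)) :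
  mx_integrable F M -> mx_integrable F N ->
  mx_integrable F (fun z => M z - N z).
Proof.
move=> Mi Ni; rewrite (_ : (fun z => _) = fun z => M z + (-1) *: N z).
  by apply: mx_integrableD => //; exact: mx_integrableZl.
by apply/funext => z; rewrite scaleN1r.
Qed.

Lemma mx_integrable_tr k l (M : T -> 'M[R]_(k, l)) :
  mx_integrable F M -> mx_integrable F (fun z => (M z)^T).
Proof.
by move=> Mi i j; rewrite (_ : (fun z => _) = fun z => M z j i)//;
  apply/funext => z; rewrite mxE.
Qed.

Lemma mx_integrableMl k l n (A : 'M[R]_(n, k)) (M : T -> 'M[R]_(k, l)) :
  mx_integrable F M -> mx_integrable F (fun z => A *m M z).
Proof.
move=> Mi i j; rewrite (_ : (fun z => _) = fun z => \sum_r A i r * M z r j).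
  by apply: integrableR_sum => r; exact: integrableRZl.
by apply/funext => z; rewrite mxE.
Qed.

Lemma mx_integrableMr k l n (A : 'M[R]_(l, n)) (M : T -> 'M[R]_(k, l)) :
  mx_integrable F M -> mx_integrable F (fun z => M z *m A).
Proof.
move=> Mi; rewrite (_ : (fun z => _) = fun z => (A^T *m (M z)^T)^T).
  apply: mx_integrable_tr; apply: mx_integrableMl; exact: mx_integrable_tr.
by apply/funext => z; rewrite trmx_mul !trmxK.
Qed.

Lemma mean_cst k l (A : 'M[R]_(k, l)) : mean F (fun=> A) = A.
Proof.
apply/matrixP => i j; rewrite mxE Rintegral_cst//.
by rewrite [fine _](congr1 fine (probability_setT F)) mulr1.
Qed.

Lemma meanD k l (M N : T -> 'M[R]_(k, l)) :
  mx_integrable F M -> mx_integrable F N ->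
  mean F (fun z => M z + N z) = mean F M + mean F N.
Proof.
move=> Mi Ni; apply/matrixP => i j; rewrite !mxE -RintegralD//.
by apply: eq_Rintegral => z _; rewrite mxE.
Qed.

Lemma meanZl k l a (M : T -> 'M[R]_(k, l)) :
  mx_integrable F M -> mean F (fun z => a *: M z) = a *: mean F M.
Proof.
move=> Mi; apply/matrixP => i j; rewrite !mxE -RintegralZl//.
by apply: eq_Rintegral => z _; rewrite mxE.
Qed.

Lemma meanB k l (M N : T -> 'M[R]_(k, l)) :
  mx_integrable F M -> mx_integrable F N ->
  mean F (fun z => M z - N z) = mean F M - mean F N.
Proof.
move=> Mi Ni; rewrite -[- mean F N]scaleN1r -meanZl// -meanD//.
  by apply: congr1; apply/funext => z; rewrite scaleN1r.
exact: mx_integrableZl.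
Qed.

Lemma mean_tr k l (M : T -> 'M[R]_(k, l)) :
  mean F (fun z => (M z)^T) = (mean F M)^T.
Proof.
by apply/matrixP => i j; rewrite !mxE; apply: eq_Rintegral => z _; rewrite mxE.
Qed.

Lemma meanMl k l n (A : 'M[R]_(n, k)) (M : T -> 'M[R]_(k, l)) :
  mx_integrable F M -> mean F (fun z => A *m M z) = A *m mean F M.
Proof.
move=> Mi; apply/matrixP => i j; rewrite !mxE.
under eq_Rintegral do rewrite mxE.
rewrite Rintegral_sum; last by move=> r; exact: integrableRZl.
by apply: eq_bigr => r _; rewrite RintegralZl// mxE.
Qed.

Lemma meanMr k l n (A : 'M[R]_(l, n)) (M : T -> 'M[R]_(k, l)) :
  mx_integrable F M -> mean F (fun z => M z *m A) = mean F M *m A.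
Proof.
move=> Mi; rewrite -[RHS]trmxK trmx_mul -mean_tr -meanMl; last first.
  exact: mx_integrable_tr.
by rewrite -mean_tr; apply: congr1; apply/funext => z; rewrite trmx_mul !trmxK.
Qed.

End MatrixMeans.

Section Moments.
Context {R : realType} {m : nat} {d} {T : measurableType d}.
Context (F : probability T R).

(** Differentiation under the integral sign.  By [separable_expansion] the
integral is a finite combination of the moments at the points [pt b], with
coefficients that do not depend on the measure; differentiating such a
combination is a finite computation. *)
Lemma trig_moment (h : 'cV[R]_m -> T -> R) : separable h ->
  (forall x, F.-integrable setT (EFin \o h x)) ->
  trig (fun x => \int[F]_z h x z) /\
  forall x t,
    pderive (fun x => \int[F]_z h x z) x t = \int[F]_z pderive (h^~ z) x t.
Proof.
move=> /separable_expansion[N [lam [pt [tlam hE]]]] hi.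
have mE : (fun x => \int[F]_z h x z) =
    (fun x => \sum_b lam b x * \int[F]_z h (pt b) z).
  apply/funext => x; under eq_Rintegral do rewrite hE.
  rewrite Rintegral_sum => [|b]; last exact: integrableRZl.
  by apply: eq_bigr => b _; rewrite RintegralZl.
have dE z x t : pderive (h^~ z) x t =
    \sum_b pderive (lam b) x t * h (pt b) z.
  rewrite -pderive_sum_trig//; congr pderive; apply/funext => y.
  exact: hE.
split; first by rewrite mE; apply: trig_sum => b; apply: trigM => //; exact: trig_cst.
move=> x t; rewrite mE pderive_sum_trig//; under [RHS]eq_Rintegral do rewrite dE.
rewrite Rintegral_sum => [|b]; last exact: integrableRZl.
by apply: eq_bigr => b _; rewrite RintegralZl.
Qed.

Definition separable_mx k l (M : 'cV[R]_m -> T -> 'M[R]_(k, l)) : Prop :=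
  forall i j, separable (fun x z => M x z i j).

Context k l (M : 'cV[R]_m -> T -> 'M[R]_(k, l)).
Context (sM : separable_mx M) (Mi : forall x, mx_integrable F (M x)).

Lemma trigmx_mean : trigmx (fun x => mean F (M x)).
Proof.
move=> i j; under eq_fun do rewrite mxE.
by apply: (trig_moment (sM i j) _).1 => x; exact: Mi.
Qed.

Lemma pderive_mean x t :
  pderive_mx (fun x => mean F (M x)) x t =
  mean F (fun z => pderive_mx (M^~ z) x t).
Proof.
apply/matrixP => i j; rewrite !mxE.
under eq_fun do rewrite mxE.
rewrite (trig_moment (sM i j) (fun x => Mi x i j)).2.
by apply: eq_Rintegral => z _; rewrite mxE.
Qed.

End Moments.

Section ObservationFamilies.
Context {R : realType} {p d s k : nat} (hdp : (d <= p)%N).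
Context (hexp : 'I_s -> nat) (fexp : 'I_k -> 'I_d -> nat).
Local Notation m := (nang p d).

Lemma rot_mx_jet (Fl : set_system R) {FF : ProperFilter Fl}
    (Fl0 : (0 : R)^' `<=` Fl) t (c : R -> R) x l : jet Fl c x l ->
  mjet Fl (fun h => rot_mx (p := p) (d := d) t (c h)) (rot_mx (d := d) t x)
    (l *: drot_mx (d := d) t x).
Proof.
move=> cx i j; rewrite !mxE; under eq_fun do rewrite mxE.
case: ifP => _; first by rewrite mulrC; exact: jet_cos.
case: ifP => _; first by rewrite mulrN mulrC; apply: jetN => //; exact: jet_sin.
case: ifP => _; first by rewrite mulrC; exact: jet_sin.
case: ifP => _; first by rewrite mulrC; exact: jet_cos.
by rewrite mulr0; exact: jet_cst.
Qed.

Lemma trigmx_rot (t : 'I_m) : trigmx (fun x : 'cV[R]_m => rot_mx (p := p) (d := d) t (x t 0)).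
Proof.
move=> i j; under eq_fun do rewrite mxE.
case: (_ && _); first exact: trig_cos.
case: (_ && _).
  under eq_fun do rewrite -mulN1r.
  by apply: trigM; [exact: trig_cst|exact: trig_sin].
case: (_ && _); first exact: trig_sin.
case: (_ && _); first exact: trig_cos.
exact: trig_cst.
Qed.

Lemma trigmx_eta : trigmx (@eta_mx R p d hdp).
Proof.
move=> i j; under eq_fun do rewrite mxE.
exact: (trigmx_bigmul _ trigmx_rot).
Qed.

(** Moving one angle along a line gives the other factors slope zero, so only
one term of the Leibniz rule survives. *)
Lemma pderive_eta (x : 'cV[R]_m) t : pderive_mx (eta_mx hdp) x t = deta_mx hdp x t.
Proof.
apply: mjet_pderive => i j; rewrite !mxE; under eq_fun do rewrite mxE.
pose A (u : 'I_m) := rot_mx (R := R) (p := p) (d := d) u (x u 0).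
pose L (u : 'I_m) := (delta_mx t 0 : 'cV[R]_m) u 0 *:
  drot_mx (R := R) (p := p) (d := d) u (x u 0).
have -> : \big[mulmx/1%:M]_(u < m) (if u == t then drot_mx (d := d) u (x u 0)
      else rot_mx (d := d) u (x u 0)) =
    \sum_t' \big[mulmx/1%:M]_u (if u == t' then L u else A u).
  rewrite (bigD1 t)//= [X in _ + X]big1 => [|t' tt'].
    rewrite addr0; apply: eq_bigr => u _; rewrite /L /A.
    by case: eqP => // ->; rewrite mxE !eqxx scale1r.
  pose P (B : 'M[R]_p) := B = 0.
  have: t' \in index_enum 'I_m by rewrite mem_index_enum.
  elim: (index_enum _) => [//|u r IHr]; rewrite inE big_cons => /orP[/eqP <-|/IHr ->].
    by rewrite eqxx /L mxE (negbTE tt') scale0r mul0mx.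
  by rewrite mulmx0.
apply: (mjet_bigmul sub_dnbhs0 (index_enum_uniq 'I_m)) => u.
by apply: rot_mx_jet => //; exact: jet_line.
Qed.

(** The chain rule for the vector of monomials.  The same computation, applied
to the coordinate lines, identifies the coefficients with the partial
derivatives that define the Jacobian. *)
Lemma gvec_jet (Fl : set_system R) {FF : ProperFilter Fl}
    (Fl0 : (0 : R)^' `<=` Fl) (c : R -> 'cV[R]_d) u w : curve_jet Fl c u w ->
  mjet Fl (fun h => gvec fexp (c h)) (gvec fexp u) (jac_gvec fexp u *m w).
Proof.
move=> cuw j i; rewrite !mxE; under eq_fun do rewrite mxE.
pose dmon l := (fexp j l)%:R * u l 0 ^+ (fexp j l).-1 *
  \prod_(l' < d | l' != l) u l' 0 ^+ fexp j l'.
have mon_jet Gl (c' : R -> 'cV[R]_d) w' : ProperFilter Gl ->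
    (0 : R)^' `<=` Gl -> curve_jet Gl c' u w' ->
    jet Gl (fun h => \prod_(l < d) (c' h) l 0 ^+ fexp j l)
      (\prod_(l < d) u l 0 ^+ fexp j l) (\sum_l w' l 0 * dmon l).
  move=> PGl Gl0 c'u.
  have -> : \sum_l w' l 0 * dmon l =
      \sum_l ((fexp j l)%:R * u l 0 ^+ (fexp j l).-1 * w' l 0) *
        \prod_(l' < d | l' != l) u l' 0 ^+ fexp j l'.
    by apply: eq_bigr => l _; rewrite /dmon mulrA [w' l 0 * _]mulrC.
  by apply: jet_prod => // l; apply: jetX => //; exact: c'u.
have jacE l : jac_gvec fexp u j l = dmon l.
  rewrite mxE; apply: jet_pderive; rewrite -(sum_delta l dmon) mxE.
  under eq_fun do rewrite mxE.
  by apply: mon_jet => // l'; exact: jet_line.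
under eq_bigr do rewrite jacE mulrC.
by rewrite ord1; exact: mon_jet.
Qed.

Lemma separable_gobs : separable_mx (fun x (z : obs R p) => gobs hdp fexp x z).
Proof.
move=> j i; rewrite (_ : (fun x => _) = fun x z => \prod_(l < d)
    (\sum_r eta_mx hdp x r l * xvec z r 0) ^+ fexp j l).
  apply: separable_prod => l; apply: separableX; apply: separable_sum => r.
  apply: separableM; first exact: separable_trig (trigmx_eta r l).
  exact: separable_fun.
apply/funext => x; apply/funext => z; rewrite mxE; apply: eq_bigr => l _.
by congr (_ ^+ _); rewrite mxE; apply: eq_bigr => r _; rewrite mxE.
Qed.

Lemma pderive_gobs x t (z : obs R p) :
  mjet 0^' (fun h => gobs hdp fexp (x + h *: delta_mx t 0) z)
    (gobs hdp fexp x z)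
    (jac_gobs hdp fexp x z *m (deta_mx hdp x t)^T *m xvec z).
Proof.
rewrite -mulmxA; apply: gvec_jet => // l.
have : mjet 0^' (fun h => (eta_mx hdp (x + h *: delta_mx t 0))^T *m xvec z)
    ((eta_mx hdp x)^T *m xvec z)
    ((deta_mx hdp x t)^T *m xvec z + (eta_mx hdp x)^T *m 0).
  apply: mjetM => //; last exact: mjet_cst.
  by apply: mjet_tr => //; rewrite -pderive_eta; exact: mjet_line trigmx_eta.
by rewrite mulmx0 addr0; apply.
Qed.

End ObservationFamilies.

(** * The gradient of the objective along a curve *)

Definition mix (R : realType) (V : lmodType R) (w : R) (A B : V) : V :=
  (1 - w) *: A + w *: B.

Section ResidualLoss.
Context {R : realType} {p s k : nat}.
(** The matrix [R] as a function of the moment matrices [R1], [R2], [R3] and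
[R4]; [dresid] is its differential, and [loss] the objective function. *)
Definition resid (N1 : 'M[R]_(p, s)) (N2 : 'M[R]_(p, k)) (N3 : 'M[R]_k)
    (N4 : 'M[R]_(k, s)) : 'M[R]_(p, s) := N1 - N2 *m invmx N3 *m N4.

Definition dresid (N2 : 'M[R]_(p, k)) (N3 : 'M[R]_k) (N4 : 'M[R]_(k, s))
    (L1 : 'M[R]_(p, s)) (L2 : 'M[R]_(p, k)) (L3 : 'M[R]_k) (L4 : 'M[R]_(k, s)) :
    'M[R]_(p, s) :=
  L1 - L2 *m invmx N3 *m N4 + N2 *m invmx N3 *m L3 *m invmx N3 *m N4
  - N2 *m invmx N3 *m L4.

Definition loss N1 N2 N3 N4 (N5 : 'M[R]_s) : R :=
  \tr (resid N1 N2 N3 N4 *m invmx N5 *m (resid N1 N2 N3 N4)^T).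

Lemma dresidD N2 N3 N4 L1 L2 L3 L4 K1 K2 K3 K4 :
  dresid N2 N3 N4 (L1 + K1) (L2 + K2) (L3 + K3) (L4 + K4) =
  dresid N2 N3 N4 L1 L2 L3 L4 + dresid N2 N3 N4 K1 K2 K3 K4.
Proof.
rewrite /dresid !(mulmxDl, mulmxDr) !opprD.
by rewrite [RHS]addrACA; congr (_ + _); rewrite [RHS]addrACA; congr (_ + _);
  rewrite [RHS]addrACA.
Qed.

Lemma dresidZ N2 N3 N4 a L1 L2 L3 L4 :
  dresid N2 N3 N4 (a *: L1) (a *: L2) (a *: L3) (a *: L4) =
  a *: dresid N2 N3 N4 L1 L2 L3 L4.
Proof.
by rewrite /dresid -!(scalemxAl, scalemxAr) -!scalerN -!scalerDr.
Qed.

Lemma dresid_sum N2 N3 N4 (I : Type) (r : seq I) L1 L2 L3 L4 :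
  dresid N2 N3 N4 (\sum_(i <- r) L1 i) (\sum_(i <- r) L2 i)
    (\sum_(i <- r) L3 i) (\sum_(i <- r) L4 i) =
  \sum_(i <- r) dresid N2 N3 N4 (L1 i) (L2 i) (L3 i) (L4 i).
Proof.
elim: r => [|i r IHr].
  by rewrite !big_nil /dresid !(mulmx0, mul0mx) !(oppr0, addr0).
by rewrite !big_cons dresidD IHr.
Qed.

Lemma mxtrace_sym_swap (A B : 'M[R]_(p, s)) (S : 'M[R]_s) : S^T = S ->
  \tr (A *m S *m B^T) = \tr (B *m S *m A^T).
Proof.
by move=> SE; rewrite -mxtrace_tr !trmx_mul trmxK SE mulmxA.
Qed.

Lemma invmx_sym n (S : 'M[R]_n) : S^T = S -> (invmx S)^T = invmx S.
Proof. by move=> SE; rewrite trmx_inv SE. Qed.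

Section ResidualJets.
Context (Fl : set_system R) {FF : ProperFilter Fl} (Fl0 : (0 : R)^' `<=` Fl).
Local Notation mjet := (mjet Fl).
Local Notation mcvg := (mcvg Fl).

Lemma resid_jet M1 M2 M3 M4 N1 N2 N3 N4 L1 L2 L3 L4 : N3 \in unitmx ->
  mjet M1 N1 L1 -> mjet M2 N2 L2 -> mjet M3 N3 L3 -> mjet M4 N4 L4 ->
  mjet (fun h => resid (M1 h) (M2 h) (M3 h) (M4 h)) (resid N1 N2 N3 N4)
    (dresid N2 N3 N4 L1 L2 L3 L4).
Proof.
move=> N3u j1 j2 j3 j4.
have J := mjetB Fl0 j1 (mjetM Fl0 (mjetM Fl0 j2 (mjet_inv Fl0 N3u j3)) j4).
have -> : dresid N2 N3 N4 L1 L2 L3 L4 = L1 - ((L2 *m invmx N3 +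
  N2 *m - (invmx N3 *m L3 *m invmx N3)) *m N4 + N2 *m invmx N3 *m L4).
  by rewrite mulmxDl !opprD mulmxN mulNmx opprK !addrA !mulmxA.
exact: J.
Qed.

(** A factor that vanishes at the base point makes continuity of the other
factor sufficient in the product rule. *)
Lemma mjet_mcvgM0 n1 n2 n3 (M : R -> 'M[R]_(n1, n2)) (N : R -> 'M[R]_(n2, n3))
    A L : mcvg M A -> mjet N 0 L -> mjet (fun h => M h *m N h) 0 (A *m L).
Proof.
move=> MA NL i j.
have quo : mcvg (fun h => M h *m (h^-1 *: N h)) (A *m L).
  apply: mcvgM => // a b; under eq_fun do rewrite mxE.
  by have := NL a b; rewrite /jet mxE; under eq_fun do rewrite subr0.
apply: cvg_trans (quo i j); apply: near_eq_cvg; near=> h => /=.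
by rewrite -scalemxAr !mxE subr0.
Unshelve. all: by end_near. Qed.

End ResidualJets.

Section Gradient.
Context {m : nat} (N1 : 'M[R]_(p, s)).
Context (A2 : 'cV[R]_m -> 'M[R]_(p, k)) (A3 : 'cV[R]_m -> 'M[R]_k).
Context (A4 : 'cV[R]_m -> 'M[R]_(k, s)) (N5 : 'M[R]_s).
Context (t2 : trigmx A2) (t3 : trigmx A3) (t4 : trigmx A4).
Context (x : 'cV[R]_m) (A3u : A3 x \in unitmx).

Lemma pderive_resid_jet t :
  mjet 0^' (fun h => let y := x + h *: delta_mx t 0 in
    resid N1 (A2 y) (A3 y) (A4 y)) (resid N1 (A2 x) (A3 x) (A4 x))
    (dresid (A2 x) (A3 x) (A4 x) 0 (pderive_mx A2 x t) (pderive_mx A3 x t)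
      (pderive_mx A4 x t)).
Proof.
apply: resid_jet => //; first exact: mjet_cst.
- exact: mjet_line.
- exact: mjet_line.
- exact: mjet_line.
Qed.

Lemma pderive_resid t :
  pderive_mx (fun y => resid N1 (A2 y) (A3 y) (A4 y)) x t =
  dresid (A2 x) (A3 x) (A4 x) 0 (pderive_mx A2 x t) (pderive_mx A3 x t)
    (pderive_mx A4 x t).
Proof. by apply: mjet_pderive; exact: pderive_resid_jet. Qed.

Lemma pderive_loss t : N5^T = N5 ->
  pderive (fun y => loss N1 (A2 y) (A3 y) (A4 y) N5) x t =
  2 * \tr (dresid (A2 x) (A3 x) (A4 x) 0 (pderive_mx A2 x t)
    (pderive_mx A3 x t) (pderive_mx A4 x t) *m invmx N5 *m
    (resid N1 (A2 x) (A3 x) (A4 x))^T).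
Proof.
move=> sym5; apply: jet_pderive; rewrite /loss.
set D := dresid _ _ _ _ _ _ _; set r := resid _ _ _ _.
have -> : 2 * \tr (D *m invmx N5 *m r^T) =
    \tr ((D *m invmx N5 + r *m 0) *m r^T + r *m invmx N5 *m D^T).
  rewrite mulmx0 addr0 mxtraceD (mxtrace_sym_swap r) ?invmx_sym//.
  by rewrite mulr_natl.
apply: jet_trace; apply: mjetM => //; first last.
  by apply: mjet_tr; exact: pderive_resid_jet.
by apply: mjetM => //; [exact: pderive_resid_jet|exact: mjet_cst].
Qed.

End Gradient.

Section GradientAlongCurve.
Context {m : nat}.
Context (A1 B1 : 'M[R]_(p, s)) (A5 B5 : 'M[R]_s).
Context (A2 B2 : 'cV[R]_m -> 'M[R]_(p, k)) (A3 B3 : 'cV[R]_m -> 'M[R]_k).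
Context (A4 B4 : 'cV[R]_m -> 'M[R]_(k, s)).
Context (tA2 : trigmx A2) (tA3 : trigmx A3) (tA4 : trigmx A4).
Context (tB2 : trigmx B2) (tB3 : trigmx B3) (tB4 : trigmx B4).
Context (symA5 : A5^T = A5) (symB5 : B5^T = B5) (A5u : A5 \in unitmx).
Context (x0 v : 'cV[R]_m).
Context (A3u : A3 x0 \in unitmx).
Context (resid0 : resid A1 (A2 x0) (A3 x0) (A4 x0) = 0).
Context (Fl : set_system R) {FF : ProperFilter Fl} (Fl0 : (0 : R)^' `<=` Fl).
Context (c : R -> 'cV[R]_m) (cx0 : curve_jet Fl c x0 v).
Context (a : R -> R) (kappa : R) (a0 : jet Fl a 0 kappa).

Let mix_jet k' l (A B : R -> 'M[R]_(k', l)) A0 B0 L K :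
  mjet Fl A A0 L -> mjet Fl B B0 K ->
  mjet Fl (fun h => mix (a h) (A h) (B h)) A0 (L + kappa *: (B0 - A0)).
Proof.
move=> jA jB.
have ja1 : jet Fl (fun h => 1 - a h) (1 - 0) (0 - kappa).
  by apply: jetB => //; exact: jet_cst.
have J := mjetD (mjetZ Fl0 ja1 jA) (mjetZ Fl0 a0 jB).
move: J; rewrite subr0 sub0r scale1r !scale0r !addr0 scale1r scaleNr.
have -> : L + kappa *: (B0 - A0) = - (kappa *: A0) + L + kappa *: B0.
  by rewrite scalerBr addrC [X in X + _]addrC addrAC.
by apply.
Qed.

Let mix_jet_cst k' l (A B : 'M[R]_(k', l)) :
  mjet Fl (fun h => mix (a h) A B) A (0 + kappa *: (B - A)).
Proof. by apply: mix_jet; exact: mjet_cst. Qed.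

Let mix_jet_curve k' l (A B : 'cV[R]_m -> 'M[R]_(k', l)) :
  trigmx A -> trigmx B ->
  mjet Fl (fun h => mix (a h) (A (c h)) (B (c h))) (A x0)
   (\sum_t v t 0 *: pderive_mx A x0 t + kappa *: (B x0 - A x0)).
Proof.
by move=> tA tB; apply: (mix_jet (K := \sum_t v t 0 *: pderive_mx B x0 t));
  exact: trigmx_jet.
Qed.

Let trigmx_mix k' l w (A B : 'cV[R]_m -> 'M[R]_(k', l)) :
  trigmx A -> trigmx B -> trigmx (fun y => mix w (A y) (B y)).
Proof. by move=> tA tB; apply: trigmxD; exact: trigmxZ. Qed.

Let pderive_mix_mcvg k' l (A B : 'cV[R]_m -> 'M[R]_(k', l)) u :
  trigmx A -> trigmx B ->
  mcvg Fl (fun h => pderive_mx (fun y => mix (a h) (A y) (B y)) (c h) u)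
    (pderive_mx A x0 u).
Proof.
move=> tA tB; under eq_fun do rewrite pderive_mx_comb//.
exact: mjet_mcvg (mix_jet_curve (trigmx_pderive u tA) (trigmx_pderive u tB)).
Qed.

(** The gradient is twice the trace of a product that contains the residual as
a factor.  Since the residual vanishes at the base point, the slope of the
gradient along any curve, in which both the angles (slope [v]) and the weight
of the mixture (slope [kappa]) may vary, involves only the first derivatives of
the residual. *)
Lemma grad_loss_jet u :
  let dR t := pderive_mx (fun y => resid A1 (A2 y) (A3 y) (A4 y)) x0 t in
  jet Fl (fun h => pderive (fun y => loss (mix (a h) A1 B1)
      (mix (a h) (A2 y) (B2 y)) (mix (a h) (A3 y) (B3 y))
      (mix (a h) (A4 y) (B4 y)) (mix (a h) A5 B5)) (c h) u) 0
    (2 * \tr (dR u *m invmx A5 *m (\sum_t v t 0 *: dR t +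
      kappa *: dresid (A2 x0) (A3 x0) (A4 x0) (B1 - A1) (B2 x0 - A2 x0)
        (B3 x0 - A3 x0) (B4 x0 - A4 x0))^T)).
Proof.
move=> dR.
have j1 := @mix_jet_cst _ _ A1 B1; have j5 := @mix_jet_cst _ _ A5 B5.
have j2 := mix_jet_curve tA2 tB2; have j3 := mix_jet_curve tA3 tB3.
have j4 := mix_jet_curve tA4 tB4.
pose r h := resid (mix (a h) A1 B1) (mix (a h) (A2 (c h)) (B2 (c h)))
  (mix (a h) (A3 (c h)) (B3 (c h))) (mix (a h) (A4 (c h)) (B4 (c h))).
pose D h := dresid (mix (a h) (A2 (c h)) (B2 (c h)))
  (mix (a h) (A3 (c h)) (B3 (c h))) (mix (a h) (A4 (c h)) (B4 (c h))) 0
  (pderive_mx (fun y => mix (a h) (A2 y) (B2 y)) (c h) u)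
  (pderive_mx (fun y => mix (a h) (A3 y) (B3 y)) (c h) u)
  (pderive_mx (fun y => mix (a h) (A4 y) (B4 y)) (c h) u).
have rj : mjet Fl r 0 (\sum_t v t 0 *: dR t +
    kappa *: dresid (A2 x0) (A3 x0) (A4 x0) (B1 - A1) (B2 x0 - A2 x0)
      (B3 x0 - A3 x0) (B4 x0 - A4 x0)).
  have rj0 := resid_jet Fl0 A3u j1 j2 j3 j4.
  rewrite resid0 dresidD dresidZ in rj0.
  have -> : \sum_t v t 0 *: dR t = dresid (A2 x0) (A3 x0) (A4 x0) 0
      (\sum_t v t 0 *: pderive_mx A2 x0 t) (\sum_t v t 0 *: pderive_mx A3 x0 t)
      (\sum_t v t 0 *: pderive_mx A4 x0 t).
    under eq_bigr do rewrite /dR pderive_resid// -dresidZ scaler0.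
    by rewrite -dresid_sum big1.
  exact: rj0.
have Dcvg : mcvg Fl D (dR u).
  rewrite /dR pderive_resid// /D /dresid.
  have i3 : mcvg Fl (fun h => invmx (mix (a h) (A3 (c h)) (B3 (c h))))
    (invmx (A3 x0)) by exact: mcvg_inv (mjet_mcvg Fl0 j3).
  have c2 : mcvg Fl (fun h => mix (a h) (A2 (c h)) (B2 (c h))) (A2 x0).
    exact: mjet_mcvg j2.
  have c4 : mcvg Fl (fun h => mix (a h) (A4 (c h)) (B4 (c h))) (A4 x0).
    exact: mjet_mcvg j4.
  have d2 := pderive_mix_mcvg (u := u) tA2 tB2.
  have d3 := pderive_mix_mcvg (u := u) tA3 tB3.
  have d4 := pderive_mix_mcvg (u := u) tA4 tB4.
  have c0 : mcvg Fl (fun=> 0 : 'M[R]_(p, s)) 0 by move=> i j; exact: cvg_cst.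
  apply: mcvgD; [apply: mcvgD; [apply: mcvgD => //|]|].
  - by apply: mcvgN; exact: mcvgM (mcvgM d2 i3) c4.
  - exact: mcvgM (mcvgM (mcvgM (mcvgM c2 i3) d3) i3) c4.
  - by apply: mcvgN; exact: mcvgM (mcvgM c2 i3) d4.
have gj : jet Fl (fun h => 2 * \tr (D h *m invmx (mix (a h) A5 B5) *m (r h)^T))
    (2 * \tr (0 : 'M[R]_p)) (2 * \tr (dR u *m invmx A5 *m (\sum_t v t 0 *: dR t +
    kappa *: dresid (A2 x0) (A3 x0) (A4 x0) (B1 - A1) (B2 x0 - A2 x0)
      (B3 x0 - A3 x0) (B4 x0 - A4 x0))^T)).
  apply: jetZ => //; apply: jet_trace; apply: mjet_mcvgM0 => //.
    by apply: mcvgM => //; apply: mcvg_inv => //; exact: mjet_mcvg j5.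
  by rewrite -trmx0; exact: mjet_tr.
move: gj; rewrite mxtrace0 mulr0; apply: eq_jet; near=> h.
have M3u : mix (a h) (A3 (c h)) (B3 (c h)) \in unitmx.
  by near: h; exact: near_unitmx A3u (mjet_mcvg Fl0 j3).
apply/esym/(@pderive_loss _ _ (fun y => mix (a h) (A2 y) (B2 y))
  (fun y => mix (a h) (A3 y) (B3 y)) (fun y => mix (a h) (A4 y) (B4 y))) => //.
- exact: trigmx_mix.
- exact: trigmx_mix.
- exact: trigmx_mix.
- by rewrite linearD !linearZ /= symA5 symB5.
Unshelve. all: by end_near. Qed.

End GradientAlongCurve.
End ResidualLoss.

(** * Mixtures, empirical measures and positive semidefiniteness *)

Section MeasureCombinations.
Local Open Scope ereal_scope.
Context {R : realType} {d} {T : measurableType d}.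

(** Mixtures and empirical measures are finite nonnegative combinations of
measures; for both, linearity in the measure extends from nonnegative to
integrable functions. *)
Lemma Rintegral_measure_comb (I : finType) (mu : {measure set T -> \bar R})
    (nu : I -> {measure set T -> \bar R}) (w : I -> R) (f : T -> R) :
  (forall i, (0 <= w i)%R) ->
  (forall g : T -> \bar R, measurable_fun setT g -> (forall z, 0 <= g z) ->
    \int[mu]_z g z = \sum_i (w i)%:E * \int[nu i]_z g z) ->
  measurable_fun setT f ->
  (forall i, (nu i).-integrable setT (EFin \o f)) ->
  (\int[mu]_z f z = \sum_i w i * \int[nu i]_z f z)%R.
Proof.
move=> w0 muE mf nuf.
have fp i : \int[nu i]_z ((EFin \o f)^\+ z) \is a fin_num.
  exact: integrable_pos_fin_num (nuf i).
have fn i : \int[nu i]_z ((EFin \o f)^\- z) \is a fin_num.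
  exact: integrable_neg_fin_num (nuf i).
have mEf : measurable_fun setT (EFin \o f) by exact/measurable_EFinP.
rewrite /Rintegral integralE.
rewrite (muE _ (measurable_funepos mEf))//.
rewrite (muE _ (measurable_funeneg mEf))//.
rewrite fineB; first last.
- by apply/sum_fin_numP => i _ _; rewrite fin_numM.
- by apply/sum_fin_numP => i _ _; rewrite fin_numM.
rewrite -!sum_fine => [|i _|i _]; rewrite ?fin_numM//.
rewrite -sumrB; apply: eq_bigr => i _.
by rewrite [in RHS]integralE fineB// !fineM// mulrBr.
Qed.

End MeasureCombinations.

Section MixtureAndEmpirical.
Context {R : realType} {d} {T : measurableType d}.

Lemma mean_mixture (a : R) (F0 F : probability T R) k l (M : T -> 'M[R]_(k, l)) :
  0 <= a <= 1 -> mx_integrable F0 M -> mx_integrable F M ->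
  mean (mixture a F0 F) M = mix a (mean F0 M) (mean F M).
Proof.
move=> a01 i0 i1; have /andP[a0 a1] := a01.
have b0 : 0 <= 1 - a by rewrite subr_ge0.
apply/matrixP => i j; rewrite /mix !mxE.
pose nu (b : bool) : {measure set T -> \bar R} := if b then F else F0.
pose w (b : bool) := if b then a else 1 - a.
rewrite (@Rintegral_measure_comb _ _ _ _ _ nu w).
- by rewrite big_bool; exact: addrC.
- by case.
- move=> g mg g0; rewrite big_bool /=.
  rewrite (eq_measure_integral
    (measure_add (mscale (NngNum b0) F0) (mscale (NngNum a0) F))); last first.
    by move=> A mA _; rewrite [RHS]measure_addE /=; rewrite /mixture a01.
  by rewrite ge0_integral_measure_add// !ge0_integral_mscale//= addeC.
- by have /integrableP[/measurable_EFinP] := i0 i j.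
- by case; [exact: i1|exact: i0].
Qed.

Lemma mean_empirical (z : nat -> T) n k l (M : T -> 'M[R]_(k, l)) :
  (forall i j, measurable_fun setT (fun x => M x i j)) ->
  mean (empirical z n) M = sample_mean z n M.
Proof.
move=> mM; apply/matrixP => i j; rewrite !mxE summxE mulr_sumr.
pose nu (r : 'I_n.+1) : {measure set T -> \bar R} := \d_(z r).
rewrite (@Rintegral_measure_comb _ _ _ _ _ nu (fun=> n.+1%:R^-1)).
- apply: eq_bigr => r _; congr (_ * _).
  rewrite /Rintegral integral_dirac//; first by rewrite diracT mul1e.
  by apply/measurable_EFinP; exact: mM.
- by move=> r; rewrite invr_ge0.
- move=> g mg g0; rewrite /empirical ge0_integral_mscale//=.
  rewrite ge0_integral_measure_sum// ge0_sume_distrr// => r _.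
  exact: integral_ge0.
- exact: mM.
- move=> r; apply/integrableP; split.
    by apply/measurable_EFinP; exact: mM.
  rewrite integral_dirac//; first by rewrite diracT mul1e ltry.
  by apply: measurableT_comp => //; apply/measurable_EFinP; exact: mM.
Qed.

Lemma mean_empirical1 (z : nat -> T) k l (M : T -> 'M[R]_(k, l)) :
  (forall i j, measurable_fun setT (fun x => M x i j)) ->
  mean (empirical z 0) M = M (z 0%N).
Proof.
by move=> mM; rewrite mean_empirical// /sample_mean big_ord1 invr1 scale1r.
Qed.

End MixtureAndEmpirical.

Section PositiveSemidefinite.
Context {R : realType}.

Definition psd n (A : 'M[R]_n) : Prop :=
  forall u : 'rV[R]_n, 0 <= (u *m A *m u^T) 0 0.

Lemma row_normsq_eq0 n (y : 'rV[R]_n) : (y *m y^T) 0 0 = 0 -> y = 0.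
Proof.
rewrite mxE; under eq_bigr do rewrite mxE -expr2.
move=> /eqP; rewrite psumr_eq0 => [/allP y0|i _]; last exact: sqr_ge0.
apply/rowP => i; rewrite mxE; apply/eqP; rewrite -sqrf_eq0.
exact: (implyP (y0 i (mem_index_enum i))).
Qed.

Lemma row_normsq_ge0 n (y : 'rV[R]_n) : 0 <= (y *m y^T) 0 0.
Proof.
by rewrite mxE; apply: sumr_ge0 => i _; rewrite mxE -expr2 sqr_ge0.
Qed.

(** Positivity of the form at [u + t (u A)] for small negative [t], where it
is [2 t |u A|^2 + O(t^2)]. *)
Lemma psd_isotropic n (A : 'M[R]_n) (u : 'rV[R]_n) : A^T = A -> psd A ->
  (u *m A *m u^T) 0 0 = 0 -> u *m A = 0.
Proof.
move=> symA psdA u0; apply: row_normsq_eq0.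
move: (row_normsq_ge0 (u *m A)) (psdA (u *m A)).
have qE t : ((u + t *: (u *m A)) *m A *m (u + t *: (u *m A))^T) 0 0 =
    t * (2 * (u *m A *m (u *m A)^T) 0 0 +
         t * (u *m A *m A *m (u *m A)^T) 0 0).
  have yAu : u *m A *m A *m u^T = u *m A *m (u *m A)^T.
    by rewrite trmx_mul symA !mulmxA.
  have -> : (u + t *: (u *m A))^T = u^T + t *: (u *m A)^T.
    by rewrite linearD linearZ.
  rewrite !mulmxDl !mulmxDr -!scalemxAl -!scalemxAr yAu.
  rewrite ![(_ + _ : 'M[R]_1) 0 0]mxE ![(_ *: _ : 'M[R]_1) 0 0]mxE u0.
  by ring.
set N : R := (u *m A *m (u *m A)^T) 0 0 in qE *.
set c : R := (u *m A *m A *m (u *m A)^T) 0 0 in qE * => N0 c0.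
have := psdA (u + (- N / (c + 1)) *: (u *m A)); rewrite qE => q0.
clear symA psdA u0 qE; apply/eqP; rewrite eq_le N0 andbT leNgt; apply/negP => Npos.
have c1 : 0 < c + 1 by lra.
have tneg : - N / (c + 1) < 0 by rewrite mulNr oppr_lt0 divr_gt0.
move: q0; rewrite nmulr_rge0//; apply/negP; rewrite -ltNge.
have -> : - N / (c + 1) * c = N / (c + 1) - N by field; lra.
have : 0 < N / (c + 1) by exact: divr_gt0.
by lra.
Qed.

(** An isotropic vector of the mixture is isotropic for the definite part.
This keeps the inverses alive along mixtures simultaneously for all angles. *)
Lemma mix_unitmx n (A B : 'M[R]_n) w : A^T = A -> psd A -> psd B ->
  A \in unitmx -> 0 <= w < 1 -> mix w A B \in unitmx.
Proof.
move=> symA psdA psdB Au /andP[w0 w1]; rewrite -row_free_unit.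
apply/inj_row_free => u uC0.
have qE : (u *m mix w A B *m u^T) 0 0 =
    (1 - w) * (u *m A *m u^T) 0 0 + w * (u *m B *m u^T) 0 0.
  rewrite mulmxDr mulmxDl -!scalemxAr -!scalemxAl.
  by rewrite [(_ + _ : 'M[R]_1) 0 0]mxE ![(_ *: _ : 'M[R]_1) 0 0]mxE.
have uA0 : u *m A = 0.
  apply: psd_isotropic => //; have := psdA u; have := psdB u.
  move: qE; rewrite uC0 mul0mx mxE.
  move: (_ 0 0) (_ 0 0) => q r.
  clear -w0 w1 => q0 r_ge0 q_ge0; apply/eqP; rewrite eq_le q_ge0 andbT.
  have w1' : 0 < 1 - w by lra.
  rewrite -(pmulr_rle0 _ w1'); have := mulr_ge0 w0 r_ge0; lra.
by rewrite -[u](mulmxK Au) uA0 mul0mx.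
Qed.

Lemma psd_mean_outer d (T : measurableType d) (F : probability T R) n
    (V : T -> 'cV[R]_n) : mx_integrable F (fun z => V z *m (V z)^T) ->
  psd (mean F (fun z => V z *m (V z)^T)).
Proof.
move=> Vi u; rewrite -meanMl// -meanMr; last exact: mx_integrableMl.
rewrite mxE; apply: Rintegral_ge0 => z _.
have -> : u *m (V z *m (V z)^T) *m u^T = (u *m V z) *m (u *m V z)^T.
  by rewrite trmx_mul !mulmxA.
by rewrite mxE big_ord1 [(_^T) _ _]mxE -expr2 sqr_ge0.
Qed.

Lemma sym_mean_outer d (T : measurableType d) (F : probability T R) n
    (V : T -> 'cV[R]_n) :
  (mean F (fun z => V z *m (V z)^T))^T = mean F (fun z => V z *m (V z)^T).
Proof.
rewrite -mean_tr; congr mean; apply/funext => z.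
by rewrite trmx_mul trmxK.
Qed.

End PositiveSemidefinite.

(** * Orthogonality to functions of a statistic *)

Section OrthogonalToPreimages.
Import HBNNSimple.
Context {R : realType} {d} {T : measurableType d} (F : probability T R).
Local Notation integrableR f := (F.-integrable setT (EFin \o f)).

Lemma integrableR_restrict (f : T -> R) A : measurable A ->
  integrableR f -> integrableR (f \_ A).
Proof.
move=> mA fi; rewrite -restrict_EFin.
by apply/(integrable_mkcond _ mA); apply: (integrableS measurableT).
Qed.

Lemma integrableR_le (f g : T -> R) : measurable_fun setT f ->
  (forall z, `|f z| <= `|g z|) -> integrableR g -> integrableR f.
Proof.
move=> mf fg gi; apply: (le_integrable measurableT _ _ gi).
  exact/measurable_EFinP.
by move=> z _ /=; rewrite lee_fin.
Qed.

Lemma integrableR_measurable (f : T -> R) :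
  integrableR f -> measurable_fun setT f.
Proof. by move=> /integrableP[/measurable_EFinP]. Qed.

(** [D] is orthogonal to the indicators of the events generated by [g]; for
[D] the error of a conditional expectation given [S], this holds for every
measurable function [g] of [S]. *)
Definition null_on_preimages (D g : T -> R) : Prop :=
  forall B : set R, measurable B -> \int[F]_(z in g @^-1` B) D z = 0.

Let Rintegral_mul_nnsfun (D g : T -> R) (q : {nnsfun R >-> R}) :
  measurable_fun setT g -> integrableR D -> null_on_preimages D g ->
  \int[F]_z (D z * q (g z)) = 0.
Proof.
move=> mg Di Dg0.
pose A r := g @^-1` (q @^-1` [set r]).
have mA r : measurable (A r) by rewrite -[A r]setTI; exact: mg.
have DqE z : D z * q (g z) =
    \sum_(r <- finmap.enum_fset (fset_set (range q))) r * (D \_ (A r)) z.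
  rewrite fimfunE fsbig_finite//= mulr_sumr; apply: eq_bigr => r _.
  rewrite patchE indicE mulrCA; congr (_ * _).
  rewrite (_ : (g z \in _) = (z \in A r)); last by apply/idP/idP; rewrite !inE.
  by case: ifP => _; rewrite ?mulr1 ?mulr0.
under eq_Rintegral do rewrite DqE.
rewrite Rintegral_sum => [|r]; last first.
  by apply: integrableRZl; exact: integrableR_restrict.
rewrite big1// => r _; rewrite RintegralZl//; last exact: integrableR_restrict.
by rewrite -Rintegral_mkcond Dg0 ?mulr0// -[X in measurable X]setTI;
  exact: measurable_funPT.
Qed.

Let Rintegral_mul_pos (D g : T -> R) : measurable_fun setT g ->
  integrableR D -> integrableR (fun z => D z * g z) ->
  null_on_preimages D g -> \int[F]_z (D z * Num.max (g z) 0) = 0.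
Proof.
move=> mg Di Dgi Dg0.
pose pos (y : R) : \bar R := (Num.max y 0)%:E.
have mpos : measurable_fun setT pos.
  by apply/measurable_EFinP; apply: measurable_maxr.
have pos0 y : [set: R] y -> (0 <= pos y)%E by rewrite lee_fin le_max lexx orbT.
pose q := nnsfun_approx measurableT mpos.
have q_cvg y : q n y @[n --> \oo] --> Num.max y 0.
  by have /fine_cvgP[] := cvg_nnsfun_approx measurableT mpos pos0 (I : setT y).
have q_le n y : q n y <= Num.max y 0.
  rewrite -(cvg_lim (@Rhausdorff R) (q_cvg y)).
  apply: nondecreasing_cvgn_le; last by apply/cvg_ex; eexists; exact: q_cvg.
  move=> a b ab; have /lefP := nd_nnsfun_approx measurableT mpos ab.
  exact.
have mD := integrableR_measurable Di.
have mDg := integrableR_measurable Dgi.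
have mmax : measurable_fun setT (fun z => Num.max (g z) 0).
  by apply: measurable_maxr.
have dom (y : R) n : `|q n y| <= `|y|.
  rewrite ger0_norm// (le_trans (q_le n y))// ge_max ler_norm normr_ge0//.
have [_ _ lim_int] : [/\ F.-integrable setT
      (fun z => (D z * Num.max (g z) 0)%:E),
    [sequence \int[F]_z `|(D z * q n (g z))%:E -
      (D z * Num.max (g z) 0)%:E|]_n @ \oo --> 0%E &
    [sequence \int[F]_z (D z * q n (g z))%:E]_n @ \oo -->
      \int[F]_z (D z * Num.max (g z) 0)%:E]%E.
  apply: (@dominated_convergence _ _ _ F setT measurableT
      (fun n z => (D z * q n (g z))%:E) (fun z => (D z * Num.max (g z) 0)%:E)
      (fun z => `|D z * g z|%:E)).
  - move=> n; apply/measurable_EFinP; apply: measurable_funM => //.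
    exact: measurableT_comp.
  - by apply/measurable_EFinP; exact: measurable_funM.
  - apply/aeW => z _; apply/fine_cvgP; split; first by near=> n.
    by apply: cvgM; [exact: cvg_cst|exact: q_cvg].
  - exact: (integrable_norm Dgi).
  - apply/aeW => z n _; rewrite lee_fin !normrM.
    by apply: ler_wpM2l => //; exact: dom.
move: lim_int; rewrite (_ : [sequence _]_n = cst 0%E); last first.
  apply/funext => n /=; rewrite -[RHS]/(0%:E).
  rewrite -(Rintegral_mul_nnsfun (q n) mg Di Dg0) fineK//.
  apply: (integrable_fin_num measurableT).
  apply: (integrableR_le _ _ Dgi).
    by apply: measurable_funM => //; exact: measurableT_comp.
  by move=> z; rewrite !normrM; apply: ler_wpM2l => //; exact: dom.
move=> /(cvg_lim (@ereal_hausdorff R)); rewrite lim_cst// => int0.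
by rewrite /Rintegral -int0.
Unshelve. all: by end_near. Qed.

(** Orthogonality extends from indicators to [g] itself, which may be unbounded:
simple functions approximate the positive part of the identity of the line from
below, and [|D g|] dominates. *)
Lemma Rintegral_mul_null (D g : T -> R) : measurable_fun setT g ->
  integrableR D -> integrableR (fun z => D z * g z) ->
  null_on_preimages D g -> \int[F]_z (D z * g z) = 0.
Proof.
move=> mg Di Dgi Dg0.
have mD := integrableR_measurable Di.
have mng : measurable_fun setT (fun z => - g z) by exact: measurableT_comp.
have Dngi : integrableR (fun z => D z * - g z).
  apply: (integrableR_le _ _ Dgi); first exact: measurable_funM.
  by move=> z; rewrite mulrN normrN.
have Dng0 : null_on_preimages D (fun z => - g z).
  move=> B mB; have -> : (fun z => - g z) @^-1` B = g @^-1` (-%R @^-1` B) by [].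
  apply: Dg0; rewrite -[X in measurable X]setTI.
  have mN : measurable_fun setT (fun y : R => - y) by exact: measurableT_comp.
  exact: (mN measurableT).
have i1 : integrableR (fun z => D z * Num.max (g z) 0).
  apply: (integrableR_le _ _ Dgi).
    by apply: measurable_funM => //; apply: measurable_maxr.
  move=> z; rewrite !normrM ler_wpM2l// ger0_norm ?le_max ?lexx ?orbT//.
  by rewrite ge_max ler_norm normr_ge0.
have i2 : integrableR (fun z => D z * Num.max (- g z) 0).
  apply: (integrableR_le _ _ Dngi).
    by apply: measurable_funM => //; apply: measurable_maxr.
  move=> z; rewrite !normrM ler_wpM2l// ger0_norm ?le_max ?lexx ?orbT//.
  by rewrite ge_max ler_norm normr_ge0.
transitivity (\int[F]_z (D z * Num.max (g z) 0) -
    \int[F]_z (D z * Num.max (- g z) 0)); last first.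
  by rewrite (Rintegral_mul_pos mg Di Dgi Dg0)
    (Rintegral_mul_pos mng Di Dngi Dng0) subrr.
rewrite -RintegralB//; apply: eq_Rintegral => z _.
rewrite -mulrBr; congr (_ * _).
by have [g0|g0] := leP 0 (g z);
  [rewrite max_r ?subr0 ?oppr_le0|rewrite max_l ?oppr_ge0 ?ltW// opprK add0r].
Qed.

End OrthogonalToPreimages.

(** * Conditional expectations and product measures *)

Section ConditionalExpectation.
Context {R : realType} {d} {T : measurableType d} (F : probability T R).
Local Notation integrableR f := (F.-integrable setT (EFin \o f)).

Lemma null_on_preimages_comp (D g : T -> R) (k : R -> R) :
  measurable_fun setT k -> null_on_preimages F D g ->
  null_on_preimages F D (k \o g).
Proof.
move=> mk Dg0 B mB; rewrite comp_preimage; apply: Dg0.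
by rewrite -[X in measurable X]setTI; exact: mk.
Qed.

(** Testing [D] against its own sign gives [\int |D| = 0]. *)
Lemma null_on_own_preimages (D : T -> R) : integrableR D ->
  null_on_preimages F D D -> {ae F, forall z, D z = 0}.
Proof.
move=> Di D0; have mD := integrableR_measurable Di.
pose A := [set y : R | 0 <= y].
have mA : measurable A.
  rewrite (_ : A = `[0, +oo[%classic); first exact: measurable_itv.
  by apply/seteqP; split=> y; rewrite /A /= in_itv/= andbT.
pose k (y : R) : R := 2 * \1_A y - 1.
have mk : measurable_fun setT k.
  by apply: measurable_funB => //; apply: measurable_funM.
have DkE z : D z * k (D z) = `|D z|.
  rewrite /k indicE; have [D0'|D0'] := leP 0 (D z).
    by rewrite mem_set// ger0_norm//=; ring.
  rewrite memNset; last by rewrite /A /= leNgt D0'.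
  by rewrite ltr0_norm//=; ring.
have Dabs : integrableR (fun z => D z * k (D z)).
  rewrite (_ : (fun z => _) = Num.norm \o D); first exact: integrable_norm.
  by apply/funext => z; rewrite DkE.
have int0 := Rintegral_mul_null (measurableT_comp mk mD) Di Dabs
  (null_on_preimages_comp mk D0).
have : (\int[F]_z `|(D z)%:E| = 0)%E.
  rewrite -[RHS]/(0%:E) -int0 /Rintegral fineK; last exact: (integrable_fin_num measurableT Dabs).
  by apply: eq_integral => z _; rewrite /= DkE.
move/(ae_eq_integral_abs F measurableT (f := EFin \o D)).
have mED : measurable_fun setT (EFin \o D) by exact/measurable_EFinP.
by move/(_ mED); apply: filterS => z /(_ I)[].
Qed.

Context {d'} {T' : measurableType d'}.

Lemma cond_exp_preimage f (S : T -> T') h B : measurable_fun setT S ->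
  cond_exp F f S h -> measurable B ->
  \int[F]_(z in S @^-1` B) (f z - h (S z)) = 0.
Proof.
move=> mS [fi mh hi fhE] mB.
have mSB : measurable (S @^-1` B) by rewrite -[X in measurable X]setTI; exact: mS.
rewrite RintegralB//; first by rewrite fhE// subrr.
- exact: integrableS fi.
- exact: integrableS hi.
Qed.

Lemma cond_exp_null f (S : T -> T') h (g : T' -> R) : measurable_fun setT S ->
  measurable_fun setT g -> cond_exp F f S h ->
  null_on_preimages F (fun z => f z - h (S z)) (g \o S).
Proof.
move=> mS mg fSh B mB; rewrite comp_preimage.
apply: cond_exp_preimage => //.
by rewrite -[X in measurable X]setTI; exact: mg.
Qed.

Context {d''} {T'' : measurableType d''}.

(** The two statistics generate the same events because each is a function of
the other. *)
Lemma cond_exp_unique f (S1 : T -> T') (S2 : T -> T'') h1 h2 t12 t21 :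
  measurable_fun setT S1 -> measurable_fun setT S2 ->
  measurable_fun setT t12 -> measurable_fun setT t21 ->
  S2 = t12 \o S1 -> S1 = t21 \o S2 ->
  cond_exp F f S1 h1 -> cond_exp F f S2 h2 ->
  {ae F, forall z, h1 (S1 z) = h2 (S2 z)}.
Proof.
move=> mS1 mS2 mt12 mt21 E12 E21 [fi mh1 h1i f1] [_ mh2 h2i f2].
have D0 : {ae F, forall z, h1 (S1 z) - h2 (S2 z) = 0}.
  apply: null_on_own_preimages; first exact: integrableRB.
  move=> B mB.
  pose C := (fun u => h1 u - h2 (t12 u)) @^-1` B.
  have mC : measurable C.
    rewrite -[X in measurable X]setTI.
    apply: measurable_funB => //; exact: measurableT_comp.
  have -> : (fun z => h1 (S1 z) - h2 (S2 z)) @^-1` B = S1 @^-1` C.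
    by rewrite {1}E12.
  have mS1C : measurable (S1 @^-1` C).
    by rewrite -[X in measurable X]setTI; exact: mS1.
  rewrite RintegralB//; first last.
  - exact: integrableS h2i.
  - exact: integrableS h1i.
  have S1E : S1 @^-1` C = S2 @^-1` (t21 @^-1` C) by rewrite {1}E21.
  rewrite -f1// S1E -f2 ?subrr//.
  by rewrite -[X in measurable X]setTI; exact: mt21.
by apply: filterS D0 => z /eqP; rewrite subr_eq0 => /eqP.
Qed.

End ConditionalExpectation.

Section ProductMeasure.
Context {R : realType} {d} {T : measurableType d} (F : probability T R).

Lemma ae_fst (Q : T -> Prop) : {ae F, forall z, Q z} ->
  {ae (F \x F)%E, forall w, Q w.1}.
Proof.
move=> [A [mA A0 QA]]; exists (A `*` setT); split.
- exact: measurableX.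
- by rewrite product_measure1E// [X in (X * _)%E](A0 : _ = _) mul0e.
- by move=> [x y] /= nQ; split => //; exact: QA.
Qed.

Lemma ae_snd (Q : T -> Prop) : {ae F, forall z, Q z} ->
  {ae (F \x F)%E, forall w, Q w.2}.
Proof.
move=> [A [mA A0 QA]]; exists (setT `*` A); split.
- exact: measurableX.
- by rewrite product_measure1E// [X in (_ * X)%E](A0 : _ = _) mule0.
- by move=> [x y] /= nQ; split => //; exact: QA.
Qed.

Lemma integrable_prod (u v : T -> R) :
  F.-integrable setT (EFin \o u) -> F.-integrable setT (EFin \o v) ->
  (F \x F)%E.-integrable setT (EFin \o (fun w => u w.1 * v w.2)).
Proof.
move=> ui vi; have mu := integrableR_measurable ui.
have mv := integrableR_measurable vi.
have muv : measurable_fun setT (fun w : T * T => u w.1 * v w.2).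
  by apply: measurable_funM; exact: measurableT_comp.
apply/integrable12ltyP; first exact/measurable_EFinP.
under eq_integral => x _.
  under eq_integral => y _ do rewrite /= normrM EFinM.
  rewrite integralZl//; last exact: integrable_norm.
  over.
rewrite /= ge0_integralZr//.
- apply: lte_mul_pinfty => //.
  + exact: integral_ge0.
  + by rewrite ge0_fin_numE ?integral_ge0//; have /integrableP[] := ui.
  + by have /integrableP[] := vi.
- by apply/measurable_EFinP; exact: measurableT_comp.
- exact: integral_ge0.
Qed.

Lemma Rintegral_prod (u v : T -> R) :
  F.-integrable setT (EFin \o u) -> F.-integrable setT (EFin \o v) ->
  \int[(F \x F)%E]_w (u w.1 * v w.2) = (\int[F]_z u z) * (\int[F]_z v z).
Proof.
move=> ui vi; have uvi := integrable_prod ui vi.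
rewrite {1}/Rintegral -integral12_prod_meas1//.
rewrite (eq_integral (fun x => (u x * \int[F]_z v z)%:E)); last first.
  move=> x _; rewrite /fubini_F /=.
  under eq_integral do rewrite EFinM.
  rewrite integralZl// EFinM /Rintegral fineK//.
  exact: (integrable_fin_num measurableT).
by rewrite -[LHS]/(\int[F]_x (u x * \int[F]_z v z)) RintegralZr.
Qed.

End ProductMeasure.

(** * The residual vanishes under the model *)

Section Measurability.
Context {R : realType} {p : nat}.

Lemma measurable_xvec (i : 'I_p) :
  measurable_fun setT (fun z : obs R p => xvec z i 0).
Proof.
rewrite (_ : (fun z => _) = (fun x : p.-tuple R => tnth x i) \o fst).
  by apply: measurableT_comp => //; exact: measurable_tnth.
by apply/funext => z; rewrite mxE.
Qed.

Lemma measurable_mulmx_xvec q (A : 'M[R]_(q, p)) j :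
  measurable_fun setT (fun z : obs R p => (A *m xvec z) j 0).
Proof.
rewrite (_ : (fun z => _) = fun z => \sum_i A j i * xvec z i 0).
  by apply: measurable_sum => i; apply: measurable_funM => //; exact: measurable_xvec.
by apply/funext => z; rewrite mxE.
Qed.

Lemma measurable_reduced q (beta : 'M[R]_(p, q)) :
  measurable_fun setT (reduced beta).
Proof.
apply/measurable_fun_tnthP => j.
rewrite (_ : _ \o _ = fun z => (beta^T *m xvec z) j 0).
  exact: measurable_mulmx_xvec.
by apply/funext => z; rewrite /= tnth_mktuple.
Qed.

Lemma measurable_tuple_mulmx q q' (A : 'M[R]_(q', q)) :
  measurable_fun setT (fun u : q.-tuple R =>
    [tuple (A *m \col_l tnth u l) j 0 | j < q']).
Proof.
apply/measurable_fun_tnthP => j.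
rewrite (_ : _ \o _ = fun u : q.-tuple R => \sum_l A j l * tnth u l).
  by apply: measurable_sum => l; apply: measurable_funM => //; exact: measurable_tnth.
apply/funext => u; rewrite /= tnth_mktuple mxE.
by apply: eq_bigr => l _; rewrite mxE.
Qed.

Lemma measurable_gvec_tuple d k (fexp : 'I_k -> 'I_d -> nat) j :
  measurable_fun setT (fun u : d.-tuple R => gvec fexp (\col_l tnth u l) j 0).
Proof.
rewrite (_ : (fun u => _) = fun u : d.-tuple R =>
    \prod_(l < d) tnth u l ^+ fexp j l).
  by apply: measurable_prod => l _; apply: measurable_funX; exact: measurable_tnth.
by apply/funext => u; rewrite mxE; apply: eq_bigr => l _; rewrite mxE.
Qed.

Lemma measurable_hvec s (hexp : 'I_s -> nat) j :
  measurable_fun setT (fun y : R => hvec hexp y j 0).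
Proof.
rewrite (_ : (fun y => _) = fun y => y ^+ hexp j); first exact: measurable_funX.
by apply/funext => y; rewrite mxE.
Qed.

Lemma reduced_mulmx q q' (beta : 'M[R]_(p, q)) (A : 'M[R]_(q, q')) :
  reduced (beta *m A) =
  (fun u => [tuple (A^T *m \col_l tnth u l) j 0 | j < q']) \o reduced beta.
Proof.
apply/funext => z; apply/eq_from_tnth => j; rewrite /= !tnth_mktuple.
rewrite trmx_mul -mulmxA; congr ((_ *m _) j 0).
by apply/colP => l; rewrite [RHS]mxE tnth_mktuple.
Qed.

Lemma outer_mxE n n' (A : 'cV[R]_n) (B : 'cV[R]_n') i j :
  (A *m B^T) i j = A i 0 * B j 0.
Proof. by rewrite mxE big_ord1 mxE. Qed.

Lemma col_span_factor q q' (beta : 'M[R]_(p, q)) (beta' : 'M[R]_(p, q')) :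
  col_span beta' `<=` col_span beta -> exists A, beta' = beta *m A.
Proof.
move=> sub; have : (beta'^T <= beta^T)%MS.
  apply/row_subP => j; have := sub (row j beta'^T)^T.
  by rewrite /col_span /= trmxK row_sub; apply.
move=> /submxP[A EA]; exists A^T.
by rewrite -[LHS]trmxK EA trmx_mul trmxK.
Qed.

End Measurability.

Section Model.
Context {R : realType} {p d s k : nat} (hdp : (d <= p)%N).
Context (hexp : 'I_s -> nat) (fexp : 'I_k -> 'I_d -> nat).
Context (hexp_const : exists j, hexp j = 0%N).
Context (F : probability (obs R p) R) (phi : 'cV[R]_(nang p d)).
Context (moments : moments_exist hdp hexp fexp F).
Context (R5u : R5 hexp F \in unitmx).
Local Notation integrableR f := (F.-integrable setT (EFin \o f)).
Local Notation G := (gobs hdp fexp phi).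
Local Notation H := (hobs hexp).

Lemma gobs_reduced z :
  G z = gvec fexp (\col_l tnth (reduced (eta_mx hdp phi) z) l).
Proof.
rewrite /gobs; congr gvec; apply/colP => l.
by rewrite [RHS]mxE tnth_mktuple.
Qed.

(** One component of [H] is the constant 1, so [H] is a column of [H H^T]. *)
Lemma integrable_hobs b : integrableR (fun z => H z b 0).
Proof.
have [j hj0] := hexp_const; have [_ _ _ _ HH] := moments.
rewrite (_ : (fun z => _) = fun z => (H z *m (H z)^T) b j); first exact: HH.
by apply/funext => z; rewrite outer_mxE [H z j 0]mxE hj0 expr0 mulr1.
Qed.

Section CondExpMatrix.
Context (C : 'M[R]_(p, k)).
Context (CE : forall i, cond_exp F (fun z => xvec z i 0)
  (reduced (eta_mx hdp phi)) (fun u => (C *m gvec fexp (\col_l tnth u l)) i 0)).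
Let V (z : obs R p) : 'cV[R]_p := xvec z - C *m G z.

Let VE i : (fun z => V z i 0) = fun z => xvec z i 0 -
  (C *m gvec fexp (\col_l tnth (reduced (eta_mx hdp phi) z) l)) i 0.
Proof.
by apply/funext => z; rewrite -gobs_reduced /V mxE [(- _ : 'cV_p) _ _]mxE.
Qed.

Let V_int i : integrableR (fun z => V z i 0).
Proof. by rewrite VE; have [? _ ? _] := CE i; exact: integrableRB. Qed.

Let VG_int : mx_integrable F (fun z => V z *m (G z)^T).
Proof.
have [_ XG GG _ _] := moments.
rewrite (_ : (fun z => _) =
    fun z => xvec z *m (G z)^T - C *m (G z *m (G z)^T)).
  by apply: mx_integrableB => //; exact: mx_integrableMl.
by apply/funext => z; rewrite /V mulmxBl mulmxA.
Qed.

Let VH_int : mx_integrable F (fun z => V z *m (H z)^T).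
Proof.
have [XH _ _ GH _] := moments.
rewrite (_ : (fun z => _) =
    fun z => xvec z *m (H z)^T - C *m (G z *m (H z)^T)).
  by apply: mx_integrableB => //; exact: mx_integrableMl.
by apply/funext => z; rewrite /V mulmxBl mulmxA.
Qed.

(** The regression error is orthogonal to functions of [eta^T X], among them
the entries of [G]. *)
Lemma regression_moment : R2 hdp fexp phi F = C *m R3 hdp fexp phi F.
Proof.
have [_ XG GG _ _] := moments.
apply/eqP; rewrite -subr_eq0 -meanMl// -meanB//; last exact: mx_integrableMl.
rewrite (_ : (fun z => _) = fun z => V z *m (G z)^T); last first.
  by apply/funext => z; rewrite /V mulmxBl mulmxA.
apply/eqP/matrixP => i j; rewrite !mxE.
under eq_Rintegral do rewrite outer_mxE.
have mg := measurable_gvec_tuple (R := R) fexp j.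
have mS := measurable_reduced (eta_mx hdp phi).
pose g := (fun u => gvec fexp (\col_l tnth u l) j 0) \o reduced (eta_mx hdp phi).
have gE : (fun z => G z j 0) = g by apply/funext => z; rewrite gobs_reduced.
have VGi := VG_int i j.
rewrite (_ : (fun z => (V z *m _) i j) = fun z => V z i 0 * g z) in VGi; last first.
  by rewrite -gE; apply/funext => z; rewrite outer_mxE.
transitivity (\int[F]_z (V z i 0 * g z)).
  by apply: eq_Rintegral => z _; rewrite -gE.
apply: Rintegral_mul_null => //; first exact: measurableT_comp.
by rewrite VE; exact: (cond_exp_null mS mg (CE i)).
Qed.

(** With [V] the regression error, the solution space condition says that
[E(V H^T) R5^-1 H(Y)] integrates to zero over every event generated by [Y].
Testing against the entries of [H(Y)] gives [E(V H^T) R5^-1 R5 = 0]. *)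
Lemma solution_moment q (beta : 'M[R]_(p, q)) : spans_solution hexp F beta ->
  col_span beta = col_span (eta_mx hdp phi) ->
  R1 hexp F = C *m R4 hdp hexp fexp phi F.
Proof.
move=> [m [e [e' sol]]] spanE; have [XH _ _ GH HH] := moments.
have [A etaE] : exists A, eta_mx hdp phi = beta *m A.
  by apply: col_span_factor; rewrite spanE.
have [A' betaE] : exists A', beta = eta_mx hdp phi *m A'.
  by apply: col_span_factor; rewrite spanE.
have mV i : {ae F, forall z, xvec z i 0 - m i (reduced beta z) = V z i 0}.
  have [mi _ _ _] := sol i.
  have := cond_exp_unique (measurable_reduced beta)
    (measurable_reduced (eta_mx hdp phi)) (measurable_tuple_mulmx A^T)
    (measurable_tuple_mulmx A'^T) _ _ mi (CE i).
  rewrite -reduced_mulmx -etaE -reduced_mulmx -betaE => /(_ erefl erefl).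
  apply: filterS => z ->; have := congr1 (fun f => f z) (VE i).
  by move=> /= ->.
pose E := mean F (fun z => V z *m (H z)^T).
have EE : E = R1 hexp F - C *m R4 hdp hexp fexp phi F.
  rewrite -meanMl// -meanB//; last exact: mx_integrableMl.
  by congr mean; apply/funext => z; rewrite /V mulmxBl mulmxA.
pose alpha := E *m invmx (R5 hexp F).
pose D i (z : obs R p) := \sum_b alpha i b * H z b 0.
have D_int i : integrableR (D i).
  by apply: integrableR_sum => b; apply: integrableRZl; exact: integrable_hobs.
have D_null i B : measurable B -> \int[F]_(z in snd @^-1` B) D i z = 0.
  move=> mB; have [_ [Xi _ ei XE] [Mi _ e'i ME] ee'] := sol i.
  pose SB := (fun w : obs R p * obs R p => w.2.2) @^-1` B.
  have mSB : measurable SB.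
    have m22 : measurable_fun setT (fun w : obs R p * obs R p => w.2.2).
      exact: measurableT_comp.
    by rewrite -[SB]setTI; exact: m22.
  have msB : measurable (snd @^-1` B : set (obs R p)).
    by rewrite -[X in measurable X]setTI; exact: measurable_snd.
  have eE : \int[(F \x F)%E]_(w in SB) e i w.2.2 =
      \int[(F \x F)%E]_(w in SB) e' i w.2.2.
    congr fine; apply: ae_eq_integral => //.
    - exact: measurable_funTS (measurable_int _ ei).
    - exact: measurable_funTS (measurable_int _ e'i).
    - by apply: filterS (ae_snd ee') => w /= ->.
  pose U z := V z *m (H z)^T *m invmx (R5 hexp F).
  have Ui : mx_integrable F U by exact: mx_integrableMr.
  have VrhoE (w : obs R p * obs R p) : V w.1 i 0 * rho hexp F w.1.2 w.2.2 =
      \sum_b U w.1 i b * H w.2 b 0.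
    have -> : \sum_b U w.1 i b * H w.2 b 0 = (U w.1 *m H w.2) i 0.
      by rewrite mxE.
    by rewrite /U -!mulmxA [RHS]mxE big_ord1 /rho mulmxA.
  have Vrho_int : (F \x F)%E.-integrable setT
      (EFin \o (fun w => V w.1 i 0 * rho hexp F w.1.2 w.2.2)).
    rewrite (_ : (fun w => _) = fun w => \sum_b U w.1 i b * H w.2 b 0).
      by apply: integrableR_sum => b; exact: (integrable_prod (Ui i b) (integrable_hobs b)).
    by apply/funext => w; rewrite VrhoE.
  have W0 : \int[(F \x F)%E]_(w in SB)
      (V w.1 i 0 * rho hexp F w.1.2 w.2.2) = 0.
    transitivity (\int[(F \x F)%E]_(w in SB)
      (xvec w.1 i 0 * rho hexp F w.1.2 w.2.2 -
       m i (reduced beta w.1) * rho hexp F w.1.2 w.2.2)).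
      congr fine; apply: ae_eq_integral => //.
      - exact: measurable_funTS (measurable_int _ Vrho_int).
      - exact: measurable_funTS (measurable_int _
          (integrableB measurableT Xi Mi)).
      - by apply: filterS (ae_fst (mV i)) => w /= <- _; rewrite mulrBl.
    rewrite RintegralB//; first by rewrite XE// ME// eE subrr.
    - exact: integrableS Xi.
    - exact: integrableS Mi.
  rewrite -[RHS]W0 Rintegral_mkcond [RHS]Rintegral_mkcond.
  pose HB b := (fun z : obs R p => H z b 0) \_ (snd @^-1` B).
  have HB_int b : integrableR (HB b).
    by apply: integrableR_restrict => //; exact: integrable_hobs.
  transitivity (\sum_b alpha i b * \int[F]_z HB b z).
    transitivity (\int[F]_z \sum_b alpha i b * HB b z).
      apply: eq_Rintegral => z _; rewrite /HB patchE; case: ifPn => zB.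
        by apply: eq_bigr => b _; rewrite patchE zB.
      by rewrite big1// => b _; rewrite patchE (negbTE zB) mulr0.
    rewrite Rintegral_sum => [|b]; last exact: integrableRZl.
    by apply: eq_bigr => b _; rewrite RintegralZl.
  transitivity (\int[(F \x F)%E]_w \sum_b U w.1 i b * HB b w.2).
    rewrite Rintegral_sum => [|b]; last first.
      exact: (integrable_prod (Ui i b) (HB_int b)).
    apply: eq_bigr => b _; rewrite (Rintegral_prod (Ui i b) (HB_int b)); congr (_ * _).
    by rewrite /alpha -meanMr// mxE.
  apply: eq_Rintegral => w _; rewrite patchE.
  have -> : (w \in SB) = (w.2 \in snd @^-1` B) by apply/idP/idP; rewrite !inE.
  case: ifPn => wB.
    by rewrite VrhoE; apply: eq_bigr => b _; rewrite /HB patchE wB.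
  by rewrite big1// => b _; rewrite /HB patchE (negbTE wB) mulr0.
have alphaR5 : alpha *m R5 hexp F = 0.
  apply/matrixP => i j; rewrite !mxE.
  transitivity (\int[F]_z (D i z * H z j 0)).
    transitivity (\int[F]_z
        \sum_b alpha i b * (H z *m (H z)^T) b j); last first.
      apply: eq_Rintegral => z _; rewrite mulr_suml; apply: eq_bigr => b _.
      by rewrite outer_mxE mulrA.
    rewrite Rintegral_sum => [|b]; last by apply: integrableRZl; exact: HH.
    by apply: eq_bigr => b _; rewrite RintegralZl ?mxE//; exact: HH.
  have Hsnd : (fun z : obs R p => H z j 0) = (fun y => hvec hexp y j 0) \o snd by [].
  have mh := measurable_hvec (R := R) hexp j.
  apply: Rintegral_mul_null => //.
  - by rewrite Hsnd; exact: measurableT_comp.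
  - rewrite (_ : (fun z => _) =
      fun z => \sum_b alpha i b * (H z *m (H z)^T) b j).
      by apply: integrableR_sum => b; apply: integrableRZl; exact: HH.
    apply/funext => z; rewrite mulr_suml; apply: eq_bigr => b _.
    by rewrite outer_mxE mulrA.
  - move=> B mB; rewrite Hsnd comp_preimage; apply: D_null.
    by rewrite -[X in measurable X]setTI; exact: mh.
apply/eqP; rewrite -subr_eq0 -EE -[E](mulmxKV R5u) -/alpha alphaR5.
exact: eqxx.
Qed.

End CondExpMatrix.
End Model.

(** * Moment matrices, their derivatives and their mixtures *)

Lemma sub_dnbhs_right (R : realType) : (0 : R)^' `<=` (0 : R)^'+.
Proof.
move=> A; rewrite /at_right /dnbhs /within /=; apply: filterS => x Ax x0.
by apply: Ax; rewrite gt_eqF.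
Qed.

Lemma dnbhs0_filter (R : realType) : ProperFilter (0 : R)^'.
Proof. exact: _. Qed.

Section MomentMatrices.
Context {R : realType} {p d s k : nat} (hdp : (d <= p)%N).
Context (hexp : 'I_s -> nat) (fexp : 'I_k -> 'I_d -> nat).
Local Notation m := (nang p d).
Implicit Types (F : probability (obs R p) R) (phi : 'cV[R]_m).

Lemma separable_mx_fun k' l (M : obs R p -> 'M[R]_(k', l)) :
  separable_mx (fun (_ : 'cV[R]_m) z => M z).
Proof. by move=> i j; exact: separable_fun. Qed.

Lemma separable_mxM k' l n (M : 'cV[R]_m -> obs R p -> 'M[R]_(k', l))
    (N : 'cV[R]_m -> obs R p -> 'M[R]_(l, n)) :
  separable_mx M -> separable_mx N ->
  separable_mx (fun x z => M x z *m N x z).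
Proof.
move=> sM sN i j; rewrite (_ : (fun x => _) =
    fun x z => \sum_r M x z i r * N x z r j).
  by apply: separable_sum => r; exact: separableM.
by apply/funext => x; apply/funext => z; rewrite mxE.
Qed.

Lemma separable_mx_tr k' l (M : 'cV[R]_m -> obs R p -> 'M[R]_(k', l)) :
  separable_mx M -> separable_mx (fun x z => (M x z)^T).
Proof.
move=> sM i j; rewrite (_ : (fun x => _) = fun x z => M x z j i); first exact: sM.
by apply/funext => x; apply/funext => z; rewrite mxE.
Qed.

Lemma separable_XG :
  separable_mx (fun phi (z : obs R p) => xvec z *m (gobs hdp fexp phi z)^T).
Proof.
apply: (separable_mxM (separable_mx_fun (@xvec R p))).
by apply: separable_mx_tr; exact: separable_gobs.
Qed.

Lemma separable_GG : separable_mx (fun phi (z : obs R p) =>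
  gobs hdp fexp phi z *m (gobs hdp fexp phi z)^T).
Proof.
apply: separable_mxM; first exact: separable_gobs.
by apply: separable_mx_tr; exact: separable_gobs.
Qed.

Lemma separable_GH : separable_mx (fun phi (z : obs R p) =>
  gobs hdp fexp phi z *m (hobs hexp z)^T).
Proof.
apply: (separable_mxM _ (separable_mx_fun (fun z => (hobs hexp z)^T))).
exact: separable_gobs.
Qed.

Lemma pderive_XG phi t (z : obs R p) :
  pderive_mx (fun x => xvec z *m (gobs hdp fexp x z)^T) phi t =
  xvec z *m (xvec z)^T *m deta_mx hdp phi t *m (jac_gobs hdp fexp phi z)^T.
Proof.
apply: mjet_pderive; rewrite -[X in mjet _ _ _ X]add0r -(mul0mx _ (gobs hdp fexp phi z)^T).
have -> : xvec z *m (xvec z)^T *m deta_mx hdp phi t *m (jac_gobs hdp fexp phi z)^T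
    = xvec z *m (jac_gobs hdp fexp phi z *m (deta_mx hdp phi t)^T *m xvec z)^T.
  by rewrite !trmx_mul trmxK !mulmxA.
apply: mjetM => //; first exact: mjet_cst.
by apply: mjet_tr; exact: pderive_gobs.
Qed.

Lemma pderive_GG phi t (z : obs R p) :
  pderive_mx (fun x => gobs hdp fexp x z *m (gobs hdp fexp x z)^T) phi t =
  jac_gobs hdp fexp phi z *m (deta_mx hdp phi t)^T *m xvec z *m
    (gobs hdp fexp phi z)^T +
  gobs hdp fexp phi z *m (xvec z)^T *m deta_mx hdp phi t *m
    (jac_gobs hdp fexp phi z)^T.
Proof.
apply: mjet_pderive.
have -> : gobs hdp fexp phi z *m (xvec z)^T *m deta_mx hdp phi t *m
      (jac_gobs hdp fexp phi z)^T = gobs hdp fexp phi z *m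
      (jac_gobs hdp fexp phi z *m (deta_mx hdp phi t)^T *m xvec z)^T.
  by rewrite !trmx_mul trmxK !mulmxA.
apply: mjetM => //; first exact: pderive_gobs.
by apply: mjet_tr; exact: pderive_gobs.
Qed.

Lemma pderive_GH phi t (z : obs R p) :
  pderive_mx (fun x => gobs hdp fexp x z *m (hobs hexp z)^T) phi t =
  jac_gobs hdp fexp phi z *m (deta_mx hdp phi t)^T *m xvec z *m (hobs hexp z)^T.
Proof.
apply: mjet_pderive.
rewrite -[X in mjet _ _ _ X]addr0 -[X in _ + X](mulmx0 _ (gobs hdp fexp phi z)).
apply: mjetM => //; first exact: pderive_gobs.
exact: mjet_cst.
Qed.

Lemma grad_ellE F phi u : grad_ell hdp hexp fexp phi F u 0 =
  pderive (fun psi => ell hdp hexp fexp psi F) phi u.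
Proof. by rewrite /grad_ell mxE. Qed.

Section FixedMeasure.
Context (F : probability (obs R p) R) (moments : moments_exist hdp hexp fexp F).

Lemma trigmx_R2 : trigmx (fun x => R2 hdp fexp x F).
Proof. by have [_ XG _ _ _] := moments; exact: trigmx_mean separable_XG XG. Qed.

Lemma trigmx_R3 : trigmx (fun x => R3 hdp fexp x F).
Proof. by have [_ _ GG _ _] := moments; exact: trigmx_mean separable_GG GG. Qed.

Lemma trigmx_R4 : trigmx (fun x => R4 hdp hexp fexp x F).
Proof. by have [_ _ _ GH _] := moments; exact: trigmx_mean separable_GH GH. Qed.

Lemma pderive_R2 phi t :
  pderive_mx (fun x => R2 hdp fexp x F) phi t = mean F (fun z =>
    xvec z *m (xvec z)^T *m deta_mx hdp phi t *m (jac_gobs hdp fexp phi z)^T).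
Proof.
have [_ XG _ _ _] := moments; rewrite (pderive_mean separable_XG XG).
by congr mean; apply/funext => z; rewrite pderive_XG.
Qed.

Lemma pderive_R3 phi t : derivative_moments_exist hdp hexp fexp phi F ->
  pderive_mx (fun x => R3 hdp fexp x F) phi t =
  mean F (fun z => jac_gobs hdp fexp phi z *m (deta_mx hdp phi t)^T *m xvec z *m
    (gobs hdp fexp phi z)^T) +
  mean F (fun z => gobs hdp fexp phi z *m (xvec z)^T *m deta_mx hdp phi t *m
    (jac_gobs hdp fexp phi z)^T).
Proof.
move=> dmom; have [_ i1 i2 _] := dmom t.
have [_ _ GG _ _] := moments; rewrite (pderive_mean separable_GG GG) -meanD//.
by congr mean; apply/funext => z; rewrite pderive_GG.
Qed.

Lemma pderive_R4 phi t :
  pderive_mx (fun x => R4 hdp hexp fexp x F) phi t = mean F (fun z =>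
    jac_gobs hdp fexp phi z *m (deta_mx hdp phi t)^T *m xvec z *m (hobs hexp z)^T).
Proof.
have [_ _ _ GH _] := moments; rewrite (pderive_mean separable_GH GH).
by congr mean; apply/funext => z; rewrite pderive_GH.
Qed.

Lemma sym_R3 phi : (R3 hdp fexp phi F)^T = R3 hdp fexp phi F.
Proof. exact: sym_mean_outer. Qed.

Lemma sym_R5 : (R5 hexp F)^T = R5 hexp F.
Proof. exact: sym_mean_outer. Qed.

Lemma psd_R3 phi : psd (R3 hdp fexp phi F).
Proof. by have [_ _ GG _ _] := moments; exact: psd_mean_outer. Qed.

Lemma psd_R5 : psd (R5 hexp F).
Proof. by have [_ _ _ _ HH] := moments; exact: psd_mean_outer. Qed.

(** [R2 = C R3] and [R1 = C R4] for the same matrix [C], hence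
[R1 - R2 R3^-1 R4 = 0]. *)
Lemma Rmx_model phi : (exists j, hexp j = 0%N) ->
  R5 hexp F \in unitmx -> R3 hdp fexp phi F \in unitmx ->
  model_assumption hdp hexp fexp F phi -> Rmx hdp hexp fexp phi F = 0.
Proof.
move=> hconst R5u R3u [[q [beta [solb ->]]] spanE _ [C CE]].
rewrite /Rmx (regression_moment moments CE).
rewrite (solution_moment hconst moments R5u CE solb spanE).
by rewrite mulmxK// subrr.
Qed.

End FixedMeasure.

Section Mixtures.
Context (F0 F : probability (obs R p) R) (a : R) (a01 : 0 <= a <= 1).
Context (mom0 : moments_exist hdp hexp fexp F0).
Context (mom : moments_exist hdp hexp fexp F).

Lemma R1_mixture : R1 hexp (mixture a F0 F) = mix a (R1 hexp F0) (R1 hexp F).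
Proof.
by have [? _ _ _ _] := mom0; have [? _ _ _ _] := mom; exact: mean_mixture.
Qed.

Lemma R2_mixture phi : R2 hdp fexp phi (mixture a F0 F) =
  mix a (R2 hdp fexp phi F0) (R2 hdp fexp phi F).
Proof.
by have [_ ? _ _ _] := mom0; have [_ ? _ _ _] := mom; exact: mean_mixture.
Qed.

Lemma R3_mixture phi : R3 hdp fexp phi (mixture a F0 F) =
  mix a (R3 hdp fexp phi F0) (R3 hdp fexp phi F).
Proof.
by have [_ _ ? _ _] := mom0; have [_ _ ? _ _] := mom; exact: mean_mixture.
Qed.

Lemma R4_mixture phi : R4 hdp hexp fexp phi (mixture a F0 F) =
  mix a (R4 hdp hexp fexp phi F0) (R4 hdp hexp fexp phi F).
Proof.
by have [_ _ _ ? _] := mom0; have [_ _ _ ? _] := mom; exact: mean_mixture.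
Qed.

Lemma R5_mixture : R5 hexp (mixture a F0 F) = mix a (R5 hexp F0) (R5 hexp F).
Proof.
by have [_ _ _ _ ?] := mom0; have [_ _ _ _ ?] := mom; exact: mean_mixture.
Qed.

Lemma inverses_mixture : a < 1 -> inverses_exist hdp hexp fexp F0 ->
  inverses_exist hdp hexp fexp (mixture a F0 F).
Proof.
move=> a1 [R5u R3u]; have /andP[a0 _] := a01; split=> [|phi phiO].
  rewrite R5_mixture mix_unitmx ?a0//; first exact: sym_R5.
  - exact: psd_R5.
  - exact: psd_R5.
rewrite R3_mixture mix_unitmx ?a0 ?R3u//; first exact: sym_R3.
- exact: psd_R3.
- exact: psd_R3.
Qed.

Lemma ell_mixture phi : ell hdp hexp fexp phi (mixture a F0 F) =
  loss (mix a (R1 hexp F0) (R1 hexp F))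
    (mix a (R2 hdp fexp phi F0) (R2 hdp fexp phi F))
    (mix a (R3 hdp fexp phi F0) (R3 hdp fexp phi F))
    (mix a (R4 hdp hexp fexp phi F0) (R4 hdp hexp fexp phi F))
    (mix a (R5 hexp F0) (R5 hexp F)).
Proof.
by rewrite -R1_mixture -R2_mixture -R3_mixture -R4_mixture -R5_mixture.
Qed.

End Mixtures.

Section Gradients.
Context (F0 : probability (obs R p) R) (phi0 : 'cV[R]_m).
Context (mom0 : moments_exist hdp hexp fexp F0).
Context (R5u : R5 hexp F0 \in unitmx) (R3u : R3 hdp fexp phi0 F0 \in unitmx).
Context (R00 : Rmx hdp hexp fexp phi0 F0 = 0).

Local Notation dR := (pderive_mx (fun x => Rmx hdp hexp fexp x F0) phi0).
Local Notation r2 := (R2 hdp fexp phi0 F0).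
Local Notation r3 := (R3 hdp fexp phi0 F0).
Local Notation r4 := (R4 hdp hexp fexp phi0 F0).

Lemma pderive_Rmx t : dR t = dresid r2 r3 r4 0
  (pderive_mx (fun x => R2 hdp fexp x F0) phi0 t)
  (pderive_mx (fun x => R3 hdp fexp x F0) phi0 t)
  (pderive_mx (fun x => R4 hdp hexp fexp x F0) phi0 t).
Proof.
exact: (pderive_resid _ (trigmx_R2 mom0) (trigmx_R3 mom0) (trigmx_R4 mom0)).
Qed.

(** The derivative of [R] at [F0] in the direction of [F], at fixed angles. *)
Definition Rmx_slope F := dresid r2 r3 r4 (R1 hexp F - R1 hexp F0)
  (R2 hdp fexp phi0 F - r2) (R3 hdp fexp phi0 F - r3)
  (R4 hdp hexp fexp phi0 F - r4).

Lemma grad_mixture_jet F (c : R -> 'cV[R]_m) v u :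
  moments_exist hdp hexp fexp F -> curve_jet 0^'+ c phi0 v ->
  jet 0^'+ (fun a => grad_ell hdp hexp fexp (c a) (mixture a F0 F) u 0) 0
    (2 * \tr (dR u *m invmx (R5 hexp F0) *m
      (\sum_t v t 0 *: dR t + Rmx_slope F)^T)).
Proof.
move=> mom cv.
have J := @grad_loss_jet R p s k m (R1 hexp F0) (R1 hexp F) (R5 hexp F0)
  (R5 hexp F) _ _ _ _ _ _
  (trigmx_R2 mom0) (trigmx_R3 mom0) (trigmx_R4 mom0)
  (trigmx_R2 mom) (trigmx_R3 mom) (trigmx_R4 mom)
  (sym_R5 _) (sym_R5 _) R5u _ _ R3u R00 _ (at_right_proper_filter 0)
  (@sub_dnbhs_right R) _ cv _ _ (jet_id (@sub_dnbhs_right R)) u.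
move: J; cbv zeta; rewrite scale1r => J.
apply: eq_jet (J _); near=> a.
have a01 : 0 <= a <= 1.
  by apply/andP; split; near: a; [exact: nbhs_right_ge|exact: nbhs_right_le].
rewrite grad_ellE; congr (pderive _ (c a) u); apply/funext => y.
by rewrite (ell_mixture a01 mom0 mom).
Unshelve. all: by end_near. Qed.

(** The coordinate line through [phi0], with a constant measure, is a curve to
which [grad_loss_jet] applies. *)
Lemma hess_ell_model t u : hess_ell hdp hexp fexp phi0 F0 t u =
  2 * \tr (dR t *m invmx (R5 hexp F0) *m (dR u)^T).
Proof.
have mix0 k' l (A : 'M[R]_(k', l)) : mix 0 A A = A.
  by rewrite /mix subr0 scale1r scale0r addr0.
have J := @grad_loss_jet R p s k m (R1 hexp F0) (R1 hexp F0) (R5 hexp F0)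
  (R5 hexp F0) _ _ _ _ _ _
  (trigmx_R2 mom0) (trigmx_R3 mom0) (trigmx_R4 mom0)
  (trigmx_R2 mom0) (trigmx_R3 mom0) (trigmx_R4 mom0)
  (sym_R5 _) (sym_R5 _) R5u _ _ R3u R00 _ (dnbhs0_filter R) (@sub_dnbhs0 R) _
  (@curve_jet_line _ _ phi0 t) _ _ (jet_cst 0) u.
have gradE psi : grad_ell hdp hexp fexp psi F0 u 0 =
    pderive (fun y => loss (mix 0 (R1 hexp F0) (R1 hexp F0))
      (mix 0 (R2 hdp fexp y F0) (R2 hdp fexp y F0))
      (mix 0 (R3 hdp fexp y F0) (R3 hdp fexp y F0))
      (mix 0 (R4 hdp hexp fexp y F0) (R4 hdp hexp fexp y F0))
      (mix 0 (R5 hexp F0) (R5 hexp F0))) psi u.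
  rewrite grad_ellE; congr (pderive _ psi u); apply/funext => y.
  by rewrite !mix0.
have grad0 : grad_ell hdp hexp fexp phi0 F0 u 0 = 0.
  rewrite grad_ellE (@pderive_loss _ _ _ _ _ (R1 hexp F0) _ _ _ (R5 hexp F0)
    (trigmx_R2 mom0) (trigmx_R3 mom0) (trigmx_R4 mom0) phi0 R3u u (sym_R5 _)).
  rewrite (_ : resid _ _ _ _ = 0); last exact: R00.
  by rewrite trmx0 mulmx0 mxtrace0 mulr0.
rewrite mxE mxtrace_sym_swap; last exact: invmx_sym (sym_R5 _).
apply: jet_pderive.
pose line_jet a := jet 0^'
  (fun h : R => grad_ell hdp hexp fexp (phi0 + h *: delta_mx t 0) F0 u 0) a
  (2 * \tr (dR u *m invmx (R5 hexp F0) *m (dR t)^T)).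
apply: (eq_ind_r line_jet _ grad0).
move: J; cbv zeta; rewrite scale0r addr0 sum_delta_mx => J.
apply: eq_jet (J _); near=> h.
by rewrite (gradE (phi0 + h *: delta_mx t 0)).
Unshelve. all: by end_near. Qed.

End Gradients.
End MomentMatrices.

(** * Stochastic order and projection *)

Section StochasticOrder.
Context {R : realType} {dO} {O : measurableType dO} (P : probability O R).

Lemma mu_ext_bigcup (I : finType) (A : I -> set O) :
  (mu_ext P (\bigcup_i A i) <= \sum_i mu_ext P (A i))%E.
Proof.
apply: (@le_trans _ _ (mu_ext P (\big[setU/set0]_(i <- index_enum I) A i))).
  by apply: le_mu_ext => w [i _ Aiw]; rewrite -bigcup_seq; exists i => //=;
    rewrite mem_index_enum.
elim: (index_enum I) => [|i r IHr]; first by rewrite !big_nil mu_ext0.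
rewrite !big_cons; apply: le_trans (outer_measureU2 (mu_ext P) _ _) _.
exact: leeD.
Qed.

(** If an entry of [A V] is large, then some entry of [V] is large on a scale
that depends only on [A]. *)
Lemma op_inv_sqrt_mulmx m m' (A : 'M[R]_(m', m)) (V : nat -> O -> 'cV[R]_m) :
  op_inv_sqrt P V -> op_inv_sqrt P (fun n w => A *m V n w).
Proof.
move=> opV i eps eps0; pose K : R := \sum_j `|A i j| + 1.
have K0 : 0 < K by rewrite ltr_wpDl// sumr_ge0.
pose S n j := [set w | eps / K < Num.sqrt n.+1%:R * `|V n w j 0|].
have sub n : [set w | eps < Num.sqrt n.+1%:R * `|(A *m V n w) i 0|] `<=`
    \bigcup_j S n j.
  move=> w /= big; apply: contrapT => small.
  have le j : Num.sqrt n.+1%:R * `|V n w j 0| <= eps / K.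
    by rewrite leNgt; apply/negP => lt; apply: small; exists j.
  move: big; apply/negP; rewrite -leNgt mxE.
  apply: (@le_trans _ _ (\sum_j `|A i j| * (eps / K))).
    apply: (@le_trans _ _ (\sum_j Num.sqrt n.+1%:R * `|A i j * V n w j 0|)).
      by rewrite -mulr_sumr ler_wpM2l ?sqrtr_ge0// ler_norm_sum.
    apply: ler_sum => j _; rewrite normrM mulrCA.
    by apply: ler_wpM2l.
  rewrite -mulr_suml mulrA ler_pdivrMr// mulrC ler_pM2l//.
  by rewrite /K lerDl.
apply: (squeeze_cvge (f := fun=> 0%E)
  (h := fun n => (\sum_j mu_ext P (S n j))%E)).
- near=> n; rewrite mu_ext_ge0//=.
  by apply: (le_trans (le_mu_ext _ (sub n))); exact: mu_ext_bigcup.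
- exact: cvg_cst.
- have : (\sum_j mu_ext P (S n j))%E @[n --> \oo] --> (\sum_(j < m) (0 : \bar R))%E.
    apply: cvg_nnesum => j _; first by near=> n; rewrite mu_ext_ge0.
    by apply: opV; rewrite divr_gt0.
  by rewrite big1.
Unshelve. all: by end_near. Qed.

End StochasticOrder.

Section Projection.
Context {R : realType} {n : nat}.

(** For symmetric [W], [Wdag W] is a symmetric idempotent with the row space
of [W], and such a projection is determined by its row space. *)
Lemma orth_proj_moore_penrose (W Wdag PW : 'M[R]_n) : W^T = W ->
  moore_penrose W Wdag -> orth_proj_on_col W PW -> PW = Wdag *m W.
Proof.
move=> symW [WdW _ _ symQ] [idPW symPW]; rewrite symPW symW => /andP[PW_W W_PW].
set Q := Wdag *m W in symQ *.
have [X EX] := submxP PW_W; have [Y EY] := submxP W_PW.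
have PQ : PW *m Q = PW by rewrite EX /Q -mulmxA [W *m _]mulmxA WdW.
have QP : Q *m PW = Q by rewrite /Q {1}EY -!mulmxA idPW -EY.
by rewrite -PQ -[PW *m Q]trmxK trmx_mul symPW symQ QP.
Qed.

End Projection.

Section Pathwise.
Context {R : realType} {p d s k : nat} (hdp : (d <= p)%N).
Context (hexp : 'I_s -> nat) (fexp : 'I_k -> 'I_d -> nat).
Local Notation m := (nang p d).
Context (F0 : probability (obs R p) R) (phi0 : 'cV[R]_m).
Context (mom0 : moments_exist hdp hexp fexp F0).
Local Notation r2 := (R2 hdp fexp phi0 F0).
Local Notation r3 := (R3 hdp fexp phi0 F0).
Local Notation r4 := (R4 hdp hexp fexp phi0 F0).

Definition Rmx_influence (z : obs R p) : 'M[R]_(p, s) := dresid r2 r3 r4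
  (xvec z *m (hobs hexp z)^T - R1 hexp F0)
  (xvec z *m (gobs hdp fexp phi0 z)^T - r2)
  (gobs hdp fexp phi0 z *m (gobs hdp fexp phi0 z)^T - r3)
  (gobs hdp fexp phi0 z *m (hobs hexp z)^T - r4).

Lemma mean_Rmx_influence F : moments_exist hdp hexp fexp F ->
  mx_integrable F Rmx_influence /\
  mean F Rmx_influence = Rmx_slope hdp hexp fexp F0 phi0 F.
Proof.
move=> [XH XG GG GH _].
have c k' l (M : obs R p -> 'M[R]_(k', l)) N : mx_integrable F M ->
    mx_integrable F (fun z => M z - N) /\ mean F (fun z => M z - N) = mean F M - N.
  move=> Mi; split; first by apply: mx_integrableB => //; exact: mx_integrable_cst.
  by rewrite meanB ?mean_cst//; exact: mx_integrable_cst.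
have [i1 e1] := c _ _ _ (R1 hexp F0) XH.
have [i2 e2] := c _ _ _ r2 (XG phi0).
have [i3 e3] := c _ _ _ r3 (GG phi0).
have [i4 e4] := c _ _ _ r4 (GH phi0).
have j2 := mx_integrableMr r4 (mx_integrableMr (invmx r3) i2).
have j3 := mx_integrableMr r4 (mx_integrableMr (invmx r3)
  (mx_integrableMl (r2 *m invmx r3) i3)).
have j4 := mx_integrableMl (r2 *m invmx r3) i4.
have i12 := mx_integrableB i1 j2; have i123 := mx_integrableD i12 j3.
split; first exact: mx_integrableB i123 j4.
rewrite /Rmx_influence /dresid (meanB i123 j4) (meanD i12 j3) (meanB i1 j2).
rewrite (meanMr r4 (mx_integrableMr (invmx r3) i2)) (meanMr (invmx r3) i2).
rewrite (meanMr r4 (mx_integrableMr (invmx r3)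
  (mx_integrableMl (r2 *m invmx r3) i3))).
rewrite (meanMr (invmx r3) (mx_integrableMl (r2 *m invmx r3) i3)).
by rewrite (meanMl (r2 *m invmx r3) i3) (meanMl (r2 *m invmx r3) i4) e1 e2 e3 e4.
Qed.

End Pathwise.

(** * Slopes of the gradient along mixtures *)

Section GradientInfluence.
Context {R : realType} {p d s k : nat} (hdp : (d <= p)%N).
Context (hexp : 'I_s -> nat) (fexp : 'I_k -> 'I_d -> nat).
Local Notation m := (nang p d).
Context (F0 F : probability (obs R p) R) (phi0 : 'cV[R]_m).
Context (mom0 : moments_exist hdp hexp fexp F0).
Context (mom : moments_exist hdp hexp fexp F).
Context (R5u : R5 hexp F0 \in unitmx) (R3u : R3 hdp fexp phi0 F0 \in unitmx).
Context (R00 : Rmx hdp hexp fexp phi0 F0 = 0).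
Local Notation dR := (pderive_mx (fun x => Rmx hdp hexp fexp x F0) phi0).
Local Notation slope := (Rmx_slope hdp hexp fexp F0 phi0 F).

Let jet_unique (f : R -> R) a l l' : jet 0^'+ f a l -> jet 0^'+ f a l' -> l = l'.
Proof. by move=> fl fl'; exact: (cvg_unique (@Rhausdorff R) fl fl'). Qed.

(** The constant curve of angles computes the influence function of
[F |-> g(phi0, F)]. *)
Lemma grad_mixture_slope u b l : b = 0 ->
  jet 0^'+ (fun a => grad_ell hdp hexp fexp phi0 (mixture a F0 F) u 0) b l ->
  l = 2 * \tr (dR u *m invmx (R5 hexp F0) *m slope^T).
Proof.
move=> -> jl; apply: jet_unique jl _.
have cst_curve : curve_jet 0^'+ (fun=> phi0) phi0 0.
  by move=> t; rewrite mxE; exact: jet_cst.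
have -> : slope = \sum_t (0 : 'cV[R]_m) t 0 *: dR t + slope.
  by rewrite big1 ?add0r// => t _; rewrite mxE scale0r.
exact: grad_mixture_jet.
Qed.

(** Along the minimizers the gradient vanishes identically, so the two
contributions to its slope cancel: the Hessian applied to the slope of the
minimizers, and the slope of the gradient at fixed angles. *)
Lemma stationary_path_slope (c : R -> 'cV[R]_m) v u :
  curve_jet 0^'+ c phi0 v ->
  (\forall a \near 0^'+, grad_ell hdp hexp fexp (c a) (mixture a F0 F) = 0) ->
  \sum_t v t 0 * (2 * \tr (dR u *m invmx (R5 hexp F0) *m (dR t)^T)) =
  - (2 * \tr (dR u *m invmx (R5 hexp F0) *m slope^T)).
Proof.
move=> cv stat.
have J := grad_mixture_jet mom0 R5u R3u R00 mom cv (u := u).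
have J0 : jet 0^'+ (fun a => grad_ell hdp hexp fexp (c a) (mixture a F0 F) u 0) 0 0.
  apply: eq_jet (jet_cst 0); apply: filterS stat => a stat_a.
  by apply/esym/(etrans (congr1 (fun M : 'cV[R]_m => M u 0) stat_a)); rewrite mxE.
have /eqP := jet_unique J J0.
move: (Rmx_slope _ _ _ _ _ _) => S; set B := dR u *m _.
rewrite linearD /= mulmxDr mxtraceD mulrDr addr_eq0 => /eqP <-.
rewrite linear_sum /= mulmx_sumr raddf_sum /= mulr_sumr.
apply: eq_bigr => t _.
by rewrite linearZ /= -scalemxAr mxtraceZ mulrCA.
Qed.

End GradientInfluence.

Section NullOnSample.
Context {R : realType} {dO} {O : measurableType dO} (P : probability O R).
Context {d} {T : measurableType d}.

(** A property of all possible values of an observation has probability one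
under its distribution. *)
Lemma ae_of_sample (X : {RV P >-> T}) (F : probability T R) (D : T -> R) :
  (forall A, measurable A -> distribution P X A = F A) ->
  measurable_fun setT D -> (forall w, D (X w) = 0) -> {ae F, forall z, D z = 0}.
Proof.
move=> XF mD D0; exists (D @^-1` [set~ 0]); split.
- rewrite -[X in measurable X]setTI; apply: mD => //.
  by apply: measurableC; exact: measurable_set1.
- rewrite -XF; last first.
    rewrite -[X in measurable X]setTI; apply: mD => //.
    by apply: measurableC; exact: measurable_set1.
  rewrite /distribution /pushforward (_ : _ @^-1` _ = set0) ?measure0//.
  by apply/seteqP; split => w //=; rewrite D0.
- by move=> z.
Qed.

End NullOnSample.

(** * The expansion of the estimator *)

Theorem theorem6p1 (R : realType) (p d s k : nat) (hdp : (d <= p)%N)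
  (hexp : 'I_s -> nat) (fexp : 'I_k -> 'I_d -> nat)
  (hexp_const : exists j, hexp j = 0%N)
  (fexp_const : exists j, forall l, fexp j l = 0%N)
  (dO : measure_display) (O : measurableType dO) (P : probability O R)
  (Z : nat -> {RV P >-> obs R p}) (F0 : probability (obs R p) R)
  (Z_iid : iid Z F0)
  (calF : set (probability (obs R p) R))
  (calF_convex : convex_class calF)
  (calF_F0 : calF F0)
  (calF_empirical : forall n w, calF (empirical (fun i => Z i w) n))
  (calF_moments : forall F, calF F -> moments_exist hdp hexp fexp F)
  (F0_inverses : inverses_exist hdp hexp fexp F0)
  (Fn_inverses : with_prob_to_one P (fun n =>
     [set w | inverses_exist hdp hexp fexp (empirical (fun i => Z i w) n)]))
  (phi : probability (obs R p) R -> 'cV[R]_(nang p d))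
  (phi_min : forall F, calF F -> inverses_exist hdp hexp fexp F ->
     is_minimizer hdp hexp fexp F (phi F))
  (F0_moments : derivative_moments_exist hdp hexp fexp (phi F0) F0)
  (F0_model : model_assumption hdp hexp fexp F0 (phi F0))
  (phistar gstar gphistar : obs R p -> 'cV[R]_(nang p d))
  (phi_frechet : frechet_with_influence calF
     (calF `&` inverses_exist hdp hexp fexp) F0 phi phistar)
  (g_frechet : frechet_with_influence calF
     (calF `&` inverses_exist hdp hexp fexp) F0
     (fun F => grad_ell hdp hexp fexp (phi F0) F) gstar)
  (gphi_frechet : frechet_with_influence calF
     (calF `&` inverses_exist hdp hexp fexp) F0
     (fun F => grad_ell hdp hexp fexp (phi F) F) gphistar)
  (phi_asymp_linear : op_inv_sqrt P (fun n w =>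
     phi (empirical (fun i => Z i w) n) - phi F0
     - sample_mean (fun i => Z i w) n phistar)) :
  let phi0 := phi F0 in
  let W := hess_ell hdp hexp fexp phi0 F0 in
  let r2 := R2 hdp fexp phi0 F0 in
  let r3 := R3 hdp fexp phi0 F0 in
  let r4 := R4 hdp hexp fexp phi0 F0 in
  let r5 := R5 hexp F0 in
  let dR := pderive_mx (fun psi => Rmx hdp hexp fexp psi F0) phi0 in
  let dR2 := pderive_mx (fun psi => R2 hdp fexp psi F0) phi0 in
  let dR3 := pderive_mx (fun psi => R3 hdp fexp psi F0) phi0 in
  let dR4 := pderive_mx (fun psi => R4 hdp hexp fexp psi F0) phi0 in
  let deta0 := pderive_mx (eta_mx hdp) phi0 in
  let X z := xvec z in
  let H z := hobs hexp z in
  let G z := gobs hdp fexp phi0 z in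
  let dG z := jac_gobs hdp fexp phi0 z in
  let R1star z := X z *m (H z)^T - mean F0 (fun z => X z *m (H z)^T) in
  let R2star z := X z *m (G z)^T - mean F0 (fun z => X z *m (G z)^T) in
  let R3star z := G z *m (G z)^T - mean F0 (fun z => G z *m (G z)^T) in
  let R4star z := G z *m (H z)^T - mean F0 (fun z => G z *m (H z)^T) in
  let Rstar z :=
    R1star z - R2star z *m invmx r3 *m r4
    + r2 *m invmx r3 *m R3star z *m invmx r3 *m r4
    - r2 *m invmx r3 *m R4star z in
  [/\
      forall Wdag PW, moore_penrose W Wdag -> orth_proj_on_col W PW ->
        op_inv_sqrt P (fun n w =>
          PW *m (phi (empirical (fun i => Z i w) n) - phi0)
          - (- (Wdag *m sample_mean (fun i => Z i w) n gstar))),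
      forall t u, W t u = 2 * \tr (dR t *m invmx r5 *m (dR u)^T),
      forall t, dR t = - (dR2 t *m invmx r3 *m r4)
        + r2 *m invmx r3 *m dR3 t *m invmx r3 *m r4
        - r2 *m invmx r3 *m dR4 t,
      forall t,
      [/\ dR2 t = mean F0 (fun z => X z *m (X z)^T *m deta0 t *m (dG z)^T),
          dR3 t = mean F0 (fun z => dG z *m (deta0 t)^T *m X z *m (G z)^T)
            + mean F0 (fun z => G z *m (X z)^T *m deta0 t *m (dG z)^T),
          dR4 t = mean F0 (fun z => dG z *m (deta0 t)^T *m X z *m (H z)^T) &
          deta0 t = deta_mx hdp phi0 t] &
      {ae F0, forall z, forall t,
        gstar z t 0 = 2 * \tr (dR t *m invmx r5 *m (Rstar z)^T)}].
Proof.
move=> phi0 W r2 r3 r4 r5 dR dR2 dR3 dR4 deta0 X H G dG R1star R2star R3star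
  R4star Rstar.
have mom0 := calF_moments _ calF_F0.
have [R5u R3u'] := F0_inverses.
have [phi0O _ grad0] := phi_min _ calF_F0 F0_inverses.
have R3u := R3u' _ phi0O.
have R00 : Rmx hdp hexp fexp phi0 F0 = 0 by exact: Rmx_model.
have WE t u : W t u = 2 * \tr (dR t *m invmx r5 *m (dR u)^T).
  exact: hess_ell_model.
clearbody W.
have sym5 : (invmx r5)^T = invmx r5 by exact: (invmx_sym (sym_R5 hexp F0)).
have symW : W^T = W.
  apply/matrixP => t u; rewrite [LHS]mxE (WE u t) (WE t u).
  exact: (congr1 (fun a => 2 * a) (mxtrace_sym_swap (dR u) (dR t) sym5)).
have [gL2 gint _ gder _] := g_frechet.
have [phiL2 phiint _ phider _] := phi_frechet.
have gE F u : calF F -> mean F gstar u 0 =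
    2 * \tr (dR u *m invmx r5 *m (Rmx_slope hdp hexp fexp F0 phi0 F)^T).
  move=> FF; apply: (grad_mixture_slope mom0 (calF_moments _ FF) R5u R3u R00 _
    (gder _ FF u)).
  by apply: (etrans (congr1 (fun M : 'cV[R]_(nang p d) => M u 0) grad0)); rewrite mxE.
(* The minimizers along the mixtures form a curve with slope [E_F phistar], on
   which the gradient vanishes. *)
have Wphi F : calF F -> W *m mean F phistar = - mean F gstar.
  move=> FF; apply/colP => u; rewrite [RHS]mxE gE//.
  rewrite -(@stationary_path_slope _ _ _ _ _ hdp hexp fexp F0 F phi0 mom0
    (calF_moments _ FF) R5u R3u R00 (fun a => phi (mixture a F0 F))
    (mean F phistar) u).
  - rewrite mxE; apply: eq_bigr => t _.
    by rewrite -(WE u t) mulrC.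
  - by move=> t; exact: phider.
  - near=> a.
    have a01 : 0 <= a <= 1.
      by apply/andP; split; near: a; [exact: nbhs_right_ge|exact: nbhs_right_le].
    have a1 : a < 1 by near: a; exact: nbhs_right_lt.
    have Fa : calF (mixture a F0 F) by exact: calF_convex.
    have inv_a := inverses_mixture a01 mom0 (calF_moments _ FF) a1 F0_inverses.
    by have [] := phi_min _ Fa inv_a.
have measurable_entries (M : obs R p -> 'cV[R]_(nang p d)) :
    mx_integrable F0 M -> forall i j, measurable_fun setT (fun z => M z i j).
  by move=> Mi i j; exact: integrableR_measurable (Mi i j).
have mg := measurable_entries _ (gint _ calF_F0).
have mphi := measurable_entries _ (phiint _ calF_F0).
have [RSi _] := mean_Rmx_influence F0 phi0 mom0.
split.
- move=> Wdag PW mpW projW.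
  have PWE := orth_proj_moore_penrose symW mpW projW.
  rewrite (_ : (fun n w => _) = fun n w => PW *m
     (phi (empirical (fun i => Z i w) n) - phi F0
     - sample_mean (fun i => Z i w) n phistar)); last first.
    apply/funext => n; apply/funext => w.
    have := Wphi _ (calF_empirical n w); rewrite !mean_empirical// => Wn.
    rewrite [in RHS]mulmxBr; congr (_ - _).
    by rewrite -[sample_mean _ _ gstar]opprK -Wn PWE mulmxN opprK mulmxA.
  exact: op_inv_sqrt_mulmx.
- exact: WE.
- move=> t; rewrite /dR pderive_Rmx// /dresid sub0r.
  by [].
- move=> t; have deta0E : deta0 t = deta_mx hdp phi0 t by exact: pderive_eta.
  rewrite deta0E; split=> //.
  + exact: (pderive_R2 mom0).
  + exact: (pderive_R3 mom0).
  + exact: (pderive_R4 mom0).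
- apply: (@filter_forall _ _ (fun t z => gstar z t 0 =
    2 * \tr (dR t *m invmx r5 *m (Rstar z)^T))) => t.
  have mD : measurable_fun setT (fun z => gstar z t 0 -
      2 * \tr (dR t *m invmx r5 *m (Rstar z)^T)).
    apply: measurable_funB; first exact: mg.
    apply: measurable_funM => //; apply: measurable_sum => i.
    exact: integrableR_measurable
      (mx_integrableMl (dR t *m invmx r5) (mx_integrable_tr RSi) i i).
  have D0 : {ae F0, forall z, gstar z t 0 -
      2 * \tr (dR t *m invmx r5 *m (Rstar z)^T) = 0}.
    apply: (ae_of_sample (Z_iid.1 0%N) mD) => w.
    (* The empirical distribution of one observation is the point mass there. *)
    have Fw := calF_empirical 0%N w.
    have := gE _ t Fw; have [_ <-] := mean_Rmx_influence F0 phi0 (calF_moments _ Fw).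
    rewrite mean_empirical1// mean_empirical1; last first.
      by move=> i j; exact: integrableR_measurable (RSi i j).
    by move=> ->; rewrite subrr.
  by apply: filterS D0 => z /eqP; rewrite subr_eq0 => /eqP.
Unshelve. all: by end_near. Qed.
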